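(* Let $\beta>1$ be a non-simple Parry number with Rényi expansion of unity $d_\beta(1)=t_1t_2t_3\cdots$, and let $\mathcal C(n)$ denote the factor complexity of the infinite word $\mathbf u_\beta$ canonically associated with $\beta$. Then $\mathcal C$ is affine (i.e. there exist constants $A,B$ with $\mathcal C(n)=An+B$ for all $n\in\mathbb N$) if and only if there exists an integer $q\ge 0$ such that $$d_\beta(1)=t_1\,\bigl(0^q\,(t_1-1)\bigr)^\omega .$$
   Context: For a real $\beta>1$ let $T_\beta(x)=\{\beta x\}$ (fractional part). The Rényi expansion of unity is $d_\beta(1)=t_1t_2t_3\cdots$ with $t_i=\lfloor \beta\,T_\beta^{i-1}(1)\rfloor$ (where $T_\beta^0(1)=1$). $\beta$ is a non-simple Parry number if $d_\beta(1)$ is eventually periodic and has infinitely many nonzero digits; one writes $d_\beta(1)=t_1\cdots t_m(t_{m+1}\cdots t_{m+p})^\omega$ with $m,p\ge1$ chosen least possible (so $t_m\neq t_{m+p}$). Over the alphabet $\mathcal A=\{0,1,\dots,m+p-1\}$ the canonical substitution $\varphi_\beta$ is the morphism with $\varphi_\beta(k)=0^{t_{k+1}}(k+1)$ for $0\le k\le m+p-2$ and $\varphi_\beta(m+p-1)=0^{t_{m+p}}m$; $\mathbf u_\beta=\lim_{n\to\infty}\varphi_\beta^n(0)$ is its unique fixed point. The factor complexity is $\mathcal C(n)=$ the number of distinct factors (finite contiguous subwords) of $\mathbf u_\beta$ of length $n$. *)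

(* Defs.v *)
From mathcomp Require Import all_boot all_order all_algebra.
From mathcomp Require Import boolp reals.

Set Implicit Arguments.
Unset Strict Implicit.
Unset Printing Implicit Defensive.

Import Order.TTheory GRing.Theory Num.Theory.
Local Open Scope ring_scope.

(* Infinite words over A are functions nat -> A, indexed from 0. *)

Definition beta_transform (R : realType) (beta x : R) : R :=
  beta * x - (Num.floor (beta * x))%:~R.

(* [renyi beta i] is the digit t_(i+1) of d_beta(1).  The floor is taken of a
   nonnegative real when beta > 1, so the absolute value only serves to turn
   the integer into a natural number. *)
Definition renyi (R : realType) (beta : R) (i : nat) : nat :=
  `|Num.floor (beta * iter i (beta_transform beta) 1)%R|%N.

(* d = d_0 ... d_(m-1) (d_m ... d_(m+p-1))^omega, with m, p >= 1 *)
Definition ultimately_periodic (d : nat -> nat) (m p : nat) : Prop :=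
  [/\ (0 < m)%N, (0 < p)%N & forall i : nat, (m <= i)%N -> d (i + p)%N = d i].

Definition nonsimple_parry (R : realType) (beta : R) : Prop :=
  (exists m p : nat, ultimately_periodic (renyi beta) m p) /\
  (forall N : nat, exists i : nat, (N <= i)%N /\ renyi beta i <> 0%N).

Definition parry_parameters (R : realType) (beta : R) (m p : nat) : Prop :=
  ultimately_periodic (renyi beta) m p /\
  (forall m' p' : nat, ultimately_periodic (renyi beta) m' p' ->
    (m <= m')%N /\ (p <= p')%N).

(* The alphabet {0, ..., m+p-1}; the form n.+1 of the bound makes ord0 and inord
   available, and (m + p).-1.+1 = m + p as soon as m or p is positive. *)
Notation alphabet m p := 'I_(m + p).-1.+1.

Definition phi_letter (d : nat -> nat) (m p : nat) (k : alphabet m p) :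
    seq (alphabet m p) :=
  rcons (nseq (d k) ord0) (if (k.+1 < m + p)%N then inord k.+1 else inord m).

Definition phi (d : nat -> nat) (m p : nat) (w : seq (alphabet m p)) :
    seq (alphabet m p) :=
  flatten [seq phi_letter d k | k <- w].

(* The limit of the words phi^n(0): if d 0 > 0, each of them is a prefix of the
   next one and phi^n(0) has more than n letters (see [fixed_wordP] below). *)
Definition fixed_word (d : nat -> nat) (m p : nat) (i : nat) : alphabet m p :=
  nth ord0 (iter i (@phi d m p) [:: ord0]) i.

Definition u_beta (R : realType) (beta : R) (m p : nat) : nat -> alphabet m p :=
  @fixed_word (renyi beta) m p.

Definition is_factor (A : finType) (u : nat -> A) (n : nat) (w : n.-tuple A) :
    Prop :=
  exists i : nat, forall j : 'I_n, tnth w j = u (i + j)%N.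

Definition complexity (A : finType) (u : nat -> A) (n : nat) : nat :=
  #|[set w : n.-tuple A | `[< is_factor u w >]]|.

Definition affine (R : realType) (C : nat -> nat) : Prop :=
  exists A B : R, forall n : nat, (C n)%:R = A * n%:R + B.

(* The infinite word v w^omega over the natural numbers, for w nonempty. *)
Definition periodic_word (v w : seq nat) (i : nat) : nat :=
  if (i < size v)%N then nth 0%N v i
  else nth 0%N w ((i - size v) %% size w).

Lemma renyi0_gt0 (R : realType) (beta : R) : 1 < beta -> (0 < renyi beta 0)%N.
Proof.
move=> beta1; rewrite /renyi /= mulr1 absz_gt0.
by rewrite gt_eqF // floor_gt0 ltW.
Qed.

Lemma fixed_wordP (d : nat -> nat) (m p : nat) : (0 < d 0)%N ->
  forall n : nat, let w := iter n (@phi d m p) [:: ord0] in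
  (n < size w)%N /\ forall i : nat, (i < size w)%N ->
    nth ord0 w i = fixed_word d m p i.
Proof.
move=> d0.
have phi_cat (v w : seq (alphabet m p)) : phi d (v ++ w) = phi d v ++ phi d w.
  by rewrite /phi map_cat flatten_cat.
have phi_size (w : seq (alphabet m p)) : (size w <= size (phi d w))%N.
  elim: w => // k w IH; rewrite -cat1s phi_cat !size_cat leq_add //.
  by rewrite addn0 size_rcons.
pose W n := iter n (@phi d m p) [:: ord0].
have WE n : exists2 v, W n.+1 = W n ++ v & (0 < size v)%N.
  elim: n => [|n [v IH v0]].
    exists (behead (phi_letter d (ord0 : alphabet m p))).
      by rewrite /W /= /phi /= cats0 /phi_letter /=; case: (d 0%N) d0.
    by rewrite size_behead size_rcons size_nseq.
  exists (phi d v); last exact: leq_trans (phi_size v).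
  by rewrite /W iterS -/(W n.+1) {1}IH phi_cat.
have Wsize n : (n < size (W n))%N.
  elim: n => // n IH; have [v -> v0] := WE n.
  by rewrite size_cat -addn1 (leq_ltn_trans _ (leq_add IH v0)) // addn1.
have Wpre n k : exists v, W (n + k)%N = W n ++ v.
  elim: k => [|k [v IH]]; first by exists [::]; rewrite addn0 cats0.
  by have [v' E _] := WE (n + k)%N; exists (v ++ v'); rewrite addnS E IH catA.
move=> n; rewrite -/(W n) /=; split=> // i lti.
rewrite /fixed_word -/(W i).
have [le_ni|/ltnW le_in] := leqP n i.
  by have [v E] := Wpre n (i - n)%N; rewrite subnKC // in E; rewrite E nth_cat lti.
have [v E] := Wpre i (n - i)%N; rewrite subnKC // in E.
by rewrite E nth_cat Wsize.
Qed.

(* Main.v *)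
(* Write N = m + p for the number of letters, f(k) for the last letter of phi(k), and t = t_1.  Every factor of u
   can be extended to the left, so C(n+1) - C(n) is the sum of (number of left extensions - 1) over the factors of
   length n, and C is affine if and only if this difference is always C(1) - C(0) = N - 1.

   Necessity.  If a and b both extend w to the left, then f(a) and f(b) both extend phi(w), except that the letters
   m - 1 and N - 1, both mapped to m by f, yield instead the new left special word 0^s m phi(w), where s is the
   smaller of the digits t_m and t_(m+p).  The images W_j under phi^j of such a word leave the prefixes of u one
   after the other, while the prefixes of u lose the left extensions 0, ..., m - 1 and keep m, ..., N - 1.  When some
   W_j appears before the extension j is lost, the difference reaches N.  Excluding this for j = 0, m - 1 and m gives
   respectively {t_m, t_(m+p)} = {t - 1, t}, equality of t_(m+1) ... t_(2m-1) with t_2 ... t_m, and a condition on the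
   run of zeros ending just before the smaller of t_m and t_(m+p).  The three together force m = 1 and
   t_2 = ... = t_p = 0.

   Sufficiency.  Each letter k >= 1 is preceded by k - 1 only.  Reading left special words as phi(w) 0^r shows that two
   nonzero left extensions occur only at prefixes of u, and that at each length at most one left special word is
   extended by 0; such a word exists, and the difference is exactly N - 1. *)

Require Import Defs.
From mathcomp Require Import all_boot all_order all_algebra.
From mathcomp Require Import boolp reals.
From mathcomp Require Import zify ring lra.

Set Implicit Arguments.
Unset Strict Implicit.
Unset Printing Implicit Defensive.

(** * Factors and left extensions *)

Section Factors.

Variables (A : finType) (u : nat -> A).

Definition pre (n : nat) : seq A := mkseq u n.

Definition is_pre (w : seq A) : bool := w == pre (size w).

(** A factor is encoded as the end of a prefix, so that facts about prefixes transfer to factors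
    without tracking positions. *)
Definition fac (w : seq A) : Prop := exists x, is_pre (x ++ w).

Definition lext (w : seq A) : {set A} := [set a | `[< fac (a :: w) >]].

Lemma size_pre n : size (pre n) = n.
Proof. exact: size_mkseq. Qed.

Lemma preS n : pre n.+1 = rcons (pre n) (u n).
Proof. by rewrite /pre mkseqS. Qed.

Lemma take_pre k n : k <= n -> take k (pre n) = pre k.
Proof.
move=> le_kn; apply: (@eq_from_nth _ (u 0)).
  by rewrite size_takel size_pre.
rewrite size_takel ?size_pre // => i lt_ik.
by rewrite nth_take // !nth_mkseq //; apply: leq_trans le_kn.
Qed.

Lemma is_prepre n : is_pre (pre n).
Proof. by rewrite /is_pre size_pre. Qed.

Lemma is_preP w : reflect (w = pre (size w)) (is_pre w).
Proof. exact: eqP. Qed.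

Lemma is_pre_prefix w w' : prefix w w' -> is_pre w' -> is_pre w.
Proof.
case/prefixP=> y -> /is_preP E; apply/is_preP.
have := congr1 (take (size w)) E.
by rewrite take_size_cat // take_pre // size_cat leq_addr.
Qed.

Lemma is_pre_catl w y : is_pre (w ++ y) -> is_pre w.
Proof. by apply: is_pre_prefix; apply: prefix_prefix. Qed.

Lemma prefix_pre m n : m <= n -> prefix (pre m) (pre n).
Proof. by move=> le_mn; rewrite prefixE size_pre take_pre. Qed.

Lemma is_pre_cmp w w' : is_pre w -> is_pre w' -> size w <= size w' -> prefix w w'.
Proof. by move=> /is_preP-> /is_preP->; rewrite !size_pre; apply: prefix_pre. Qed.

Lemma fac_catr x w : fac (x ++ w) -> fac w.
Proof. by case=> y Ey; exists (y ++ x); rewrite -catA. Qed.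

Lemma fac_catl w y : fac (w ++ y) -> fac w.
Proof. by case=> x; rewrite catA => /is_pre_catl ?; exists x. Qed.

Lemma fac_prefix w w' : prefix w w' -> fac w' -> fac w.
Proof. by case/prefixP=> y ->; apply: fac_catl. Qed.

Lemma fac_cons_prefix a w w' : prefix w w' -> fac (a :: w') -> fac (a :: w).
Proof. by move=> pw; apply: fac_prefix; rewrite /= eqxx. Qed.

Lemma is_pre_fac w : is_pre w -> fac w.
Proof. by exists [::]. Qed.

Lemma lextE a w : (a \in lext w) = `[< fac (a :: w) >].
Proof. by rewrite inE. Qed.

Lemma facP (w : seq A) : (exists i, forall j, j < size w -> nth (u 0) w j = u (i + j)) <-> fac w.
Proof.
split=> [[i Ei]|[x /is_preP E]].
  exists (pre i); apply/is_preP/(@eq_from_nth _ (u 0)).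
    by rewrite size_cat !size_pre.
  move=> k; rewrite size_cat size_pre => lt_k.
  rewrite [RHS]nth_mkseq ?size_cat ?size_pre // nth_cat size_pre.
  case: ltnP => [lt_ki|le_ik]; first by rewrite nth_mkseq.
  by rewrite Ei ?subnKC // ltn_subLR.
exists (size x) => j lt_j.
have := congr1 (fun s => nth (u 0) s (size x + j)) E.
rewrite nth_cat ltnNge leq_addr /= addKn => ->.
by rewrite nth_mkseq // size_cat ltn_add2l.
Qed.

Lemma is_factorE n (w : n.-tuple A) : is_factor u w <-> fac w.
Proof.
rewrite -facP; split=> -[i Ei]; exists i => j.
  rewrite size_tuple => lt_jn.
  by have := Ei (Ordinal lt_jn); rewrite (tnth_nth (u 0)).
by rewrite (tnth_nth (u 0)) Ei // size_tuple.
Qed.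

Lemma complexityE n : complexity u n = \sum_(w : n.-tuple A) `[< fac w >].
Proof.
rewrite /complexity cardsE -sum1_card big_mkcond; apply: eq_bigr => w _.
rewrite unfold_in /=.
by have -> : `[< is_factor u w >] = `[< fac w >] by apply: asbool_equiv_eq; exact: is_factorE.
Qed.

Lemma complexityS n : complexity u n.+1 = \sum_(w : n.-tuple A) #|lext w|.
Proof.
rewrite complexityE.
transitivity (\sum_(w : n.-tuple A) \sum_(a : A) `[< fac (a :: w) >]); last first.
  apply: eq_bigr => w _; rewrite -sum1_card [RHS]big_mkcond; apply: eq_bigr => a _.
  by rewrite lextE; case: asbool.
rewrite exchange_big pair_big.
rewrite (reindex (fun q : A * n.-tuple A => [tuple of q.1 :: q.2])) //=.
exists (fun t : n.+1.-tuple A => (thead t, [tuple of behead t])) => [[a t] _|t _].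
  by rewrite /= theadE; congr pair; apply: val_inj.
by rewrite /= -tuple_eta.
Qed.

Lemma lext_fac a w : a \in lext w -> fac w.
Proof. by rewrite lextE => /asboolP; rewrite -cat1s; apply: fac_catr. Qed.

Lemma complexity0 : complexity u 0 = 1.
Proof.
rewrite complexityE (big_pred1 [tuple]) => [|w]; last by rewrite [w]tuple0 /= eqxx.
by rewrite asboolT //; exists [::]; apply: is_prepre 0.
Qed.

Lemma complexity1 : (forall a, fac [:: a]) -> complexity u 1 = #|A|.
Proof.
move=> fA; rewrite complexityE (eq_bigr (fun=> 1)); last first.
  by case=> -[|a [|b w]] //= sw _; rewrite asboolT //; apply: fA.
by rewrite sum1_card card_tuple expn1.
Qed.

Hypothesis recurrent : forall w, fac w -> exists a, fac (a :: w).

Definition pre_tuple n : n.-tuple A := tcast (size_pre n) (in_tuple (pre n)).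

Lemma val_pre_tuple n : pre_tuple n = pre n :> seq A.
Proof. by rewrite val_tcast. Qed.

Lemma lext_gt0 n (w : n.-tuple A) : fac w -> 0 < #|lext w|.
Proof.
by case/recurrent=> a fa; apply/card_gt0P; exists a; rewrite lextE; apply/asboolP.
Qed.

Lemma lext_notfac (w : seq A) : ~ fac w -> #|lext w| = 0.
Proof.
by move=> nf; apply: eq_card0 => a; apply/negP => /lext_fac.
Qed.

(** By recurrence each factor of length n has at least one left extension, and the complexity gains
    exactly the surplus. *)
Lemma complexity_diff n :
  complexity u n.+1 = complexity u n + \sum_(w : n.-tuple A) (#|lext w|).-1.
Proof.
rewrite complexityS complexityE -big_split; apply: eq_bigr => w _ /=.
case: asboolP => fw; first by rewrite add1n prednK // lext_gt0.
by rewrite lext_notfac.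
Qed.

(** The list [s] holds left special words other than the prefix; each adds at least 1 to the
    contribution of the prefix. *)
Lemma complexity_diff_ge n (s : seq (seq A)) :
  uniq s -> all (fun w => (size w == n) && (w != pre n) && (1 < #|lext w|)) s ->
  complexity u n + (#|lext (pre n)|.-1 + size s) <= complexity u n.+1.
Proof.
move=> us /allP sP; rewrite complexity_diff leq_add2l.
rewrite (bigD1 (pre_tuple n)) //= val_pre_tuple leq_add2l.
pose B := [set w : n.-tuple A | (w != pre_tuple n) && (1 < #|lext w|)].
have leB : size s <= #|B|.
  rewrite -(size_map (fun w => insubd (pre_tuple n) w)).
  have us' : uniq [seq (insubd (pre_tuple n) w : n.-tuple A) | w <- s].
    rewrite map_inj_in_uniq // => w w' /sP /andP[/andP[sw _] _] /sP/andP[/andP[sw' _] _].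
    by move=> /(congr1 val); rewrite !insubdK.
  rewrite -(card_uniqP us'); apply/subset_leq_card/subsetP => t /mapP[w /sP].
  move=> /andP[/andP[sw nw] lw] ->; rewrite inE insubdK // lw andbT.
  by apply: contra nw => /eqP/(congr1 val); rewrite insubdK // => ->; rewrite /= val_pre_tuple.
apply: leq_trans leB _; rewrite -sum1_card.
rewrite big_mkcond [X in _ <= X]big_mkcond; apply: leq_sum => w _.
by rewrite inE; case: (w != pre_tuple n) => //=; case: #|lext w| => [|[|k]].
Qed.

End Factors.

(** * The substitution and its fixed point *)

Section Substitution.

Variables (d : nat -> nat) (m p : nat).
Hypotheses (m_gt0 : 0 < m) (p_gt0 : 0 < p).

Local Notation A := (alphabet m p).
Local Notation ph := (@phi d m p).
Local Notation O := (ord0 : A).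

Definition nextl (k : A) : A := if k.+1 < m + p then inord k.+1 else inord m.

Lemma ltn_alphabet (k : A) : k < m + p.
Proof. by apply: leq_trans (ltn_ord k) _; rewrite prednK // addn_gt0 m_gt0. Qed.

Lemma inordE k : k < m + p -> (inord k : A) = k :> nat.
Proof. by move=> ltk; rewrite inordK // prednK // addn_gt0 m_gt0. Qed.

Lemma nextl_val (k : A) : nextl k = (if k.+1 < m + p then k.+1 else m) :> nat.
Proof. by rewrite /nextl; case: ifP => lt; rewrite inordE // -[X in X < _]addn0 ltn_add2l. Qed.

Lemma nextl_neq0 k : nextl k != O.
Proof. by rewrite -val_eqE /= nextl_val; case: ifP => // _; rewrite -lt0n. Qed.

Lemma iter_nextl_val j (k : A) : k + j < m + p -> iter j nextl k = k + j :> nat.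
Proof.
elim: j => [|j IH] lt /=; first by rewrite addn0.
by rewrite nextl_val IH; [rewrite -addnS lt | lia].
Qed.

Lemma iter_nextl0_val j : j < m + p -> iter j nextl O = j :> nat.
Proof. by move=> lt; rewrite iter_nextl_val. Qed.

(** [nextl] passes once through 0, ..., m - 1 and then cycles through the p remaining letters. *)
Lemma iter_nextl_wrap j (k : A) : m <= k + j ->
  iter j nextl k = m + (k + j - m) %% p :> nat.
Proof.
elim: j => [|j IH] le /=.
  rewrite addn0 in le *; rewrite modn_small ?subnKC //.
  by have := ltn_alphabet k; lia.
rewrite nextl_val; have [le'|gt] := leqP m (k + j).
  rewrite IH // addnS subSn //.
  have -> : (k + j - m).+1 %% p = ((k + j - m) %% p).+1 %% p.
    by rewrite -addn1 -modnDml addn1.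
  have := ltn_pmod (k + j - m) p_gt0; move: (_ %% p) => x lt.
  rewrite -addnS ltn_add2l; case: ltnP => [/modn_small-> //|ge].
  by have -> : x.+1 = p by [lia]; rewrite modnn addn0.
have Em : k + j.+1 = m by lia.
rewrite iter_nextl_val ?Em ?subnn ?mod0n; last by lia.
by rewrite addn0 -addnS Em; case: ifP.
Qed.

Lemma iter_nextl_reach (k l : A) n : m <= l ->
  exists2 j, n <= j & iter j nextl k = l.
Proof.
move=> le_ml; have lt_l := ltn_alphabet l.
have mp : m + p = (m + p).-1.+1 by rewrite prednK // addn_gt0 m_gt0.
(* With this j, k + j - m is l - m plus a multiple of p; the terms n p and k p give j >= n and keep
   the subtraction exact. *)
exists (n * p + k * p + m * p + l - k).
  have : n <= n * p by rewrite leq_pmulr.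
  have : k <= k * p by rewrite leq_pmulr.
  lia.
apply: val_inj; rewrite /= iter_nextl_wrap.
  have le1 : k <= k * p by rewrite leq_pmulr.
  have -> : k + (n * p + k * p + m * p + l - k) - m = (n + k + m) * p + (l - m).
    by rewrite !mulnDl; lia.
  by rewrite modnMDl modn_small; lia.
have : k <= k * p by rewrite leq_pmulr.
have : m <= m * p by rewrite leq_pmulr.
lia.
Qed.

Lemma phi_cat v w : ph (v ++ w) = ph v ++ ph w.
Proof. by rewrite /phi map_cat flatten_cat. Qed.

Lemma phi_cons k w : ph (k :: w) = nseq (d k) O ++ nextl k :: ph w.
Proof. by rewrite -cat1s phi_cat /= /phi /= cats0 cat_rcons. Qed.

Lemma phi1 k : ph [:: k] = rcons (nseq (d k) O) (nextl k).
Proof. by rewrite phi_cons cats1. Qed.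

Lemma iter_phi_cat i v w : iter i ph (v ++ w) = iter i ph v ++ iter i ph w.
Proof. by elim: i => //= i ->; rewrite phi_cat. Qed.

Lemma size_phi w : size w <= size (ph w).
Proof.
by elim: w => // k w IH; rewrite phi_cons size_cat size_nseq /= addnS ltnS; lia.
Qed.

Lemma size_iter_phi i w : size w <= size (iter i ph w).
Proof. by elim: i => //= i IH; apply: leq_trans IH (size_phi _). Qed.

Lemma size_iter_phi_le i j w : i <= j -> size (iter i ph w) <= size (iter j ph w).
Proof. by move=> le; rewrite -(subnK le) iterD size_iter_phi. Qed.

Lemma prefix_phi v w : prefix v w -> prefix (ph v) (ph w).
Proof. by case/prefixP=> y ->; rewrite phi_cat prefix_prefix. Qed.

Lemma prefix_iter_phi i v w : prefix v w -> prefix (iter i ph v) (iter i ph w).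
Proof. by elim: i => //= i IH /IH; apply: prefix_phi. Qed.

(* phi^i(k) without its last letter. *)
Fixpoint body i (k : A) : seq A :=
  if i is i'.+1 then iter i' ph (nseq (d k) O) ++ body i' (nextl k) else [::].

Lemma iter_phi1 i k : iter i ph [:: k] = rcons (body i k) (iter i nextl k).
Proof.
elim: i k => // i IH k.
by rewrite iterSr phi1 -cats1 iter_phi_cat IH /= rcons_cat -iterSr.
Qed.

(** * Prefixes and factors of the fixed point, and their decoding into blocks *)

Hypothesis d0_gt0 : 0 < d 0.

Local Notation u := (fixed_word d m p).
Local Notation pre := (pre u).
Local Notation is_pre := (is_pre u).
Local Notation fac := (fac u).

Lemma is_pre_iter0 n : is_pre (iter n ph [:: O]).
Proof.
have [_ E] := @fixed_wordP d m p d0_gt0 n.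
apply/is_preP/(@eq_from_nth _ O); rewrite ?size_pre // => i lt_i.
by rewrite nth_mkseq // E.
Qed.

Lemma size_iter0 n : n < size (iter n ph [:: O]).
Proof. by have [] := @fixed_wordP d m p d0_gt0 n. Qed.

(** A prefix of u is a prefix of some phi^n(0), whose image is phi^(n+1)(0). *)
Lemma is_pre_phi w : is_pre w -> is_pre (ph w).
Proof.
move=> pw; apply: (@is_pre_prefix _ _ _ (ph (iter (size w) ph [:: O]))).
  apply/prefix_phi/(is_pre_cmp pw); first exact: is_pre_iter0.
  exact/ltnW/size_iter0.
exact: is_pre_iter0 (size w).+1.
Qed.

Lemma is_pre_iter_phi i w : is_pre w -> is_pre (iter i ph w).
Proof. by elim: i => //= i IH /IH; apply: is_pre_phi. Qed.

Lemma fac_phi w : fac w -> fac (ph w).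
Proof. by case=> x /is_pre_phi; rewrite phi_cat; exists (ph x). Qed.

Lemma fac_iter_phi i w : fac w -> fac (iter i ph w).
Proof. by elim: i => //= i IH /IH; apply: fac_phi. Qed.

Lemma fac_phi_cons a w : fac (a :: w) -> fac (nextl a :: ph w).
Proof. by move/fac_phi; rewrite phi_cons; apply: fac_catr. Qed.

Lemma fac_iter_phi_cons i a w :
  fac (a :: w) -> fac (iter i nextl a :: iter i ph w).
Proof. by elim: i => //= i IH /IH; apply: fac_phi_cons. Qed.

Lemma fac_phi_pre a n : fac (a :: pre n) -> fac (nextl a :: pre n).
Proof.
move/fac_phi_cons; apply: fac_cons_prefix; apply: (@is_pre_cmp _ u).
- exact: is_prepre.
- exact/is_pre_phi/is_prepre.
exact: size_phi.
Qed.

Lemma fac_iter_pre i a n : fac (a :: pre n) -> fac (iter i nextl a :: pre n).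
Proof. by elim: i => //= i IH /IH; apply: fac_phi_pre. Qed.

Lemma is_pre_nseq0 r : r <= d 0 -> is_pre (nseq r O).
Proof.
move=> le; apply: (@is_pre_prefix _ _ _ (ph [:: O])); last exact: is_pre_iter0 1.
by rewrite phi1 -(subnKC le) /= nseqD rcons_cat prefix_prefix.
Qed.

Lemma fac_letter (k : A) : fac [:: k].
Proof.
have : fac (iter k ph [:: O]) by apply/fac_iter_phi/is_pre_fac/(is_pre_nseq0 (r := 1)).
rewrite iter_phi1 -cats1 => /fac_catr; congr (fac [:: _]).
by apply: val_inj; rewrite /= iter_nextl0_val // ltn_alphabet.
Qed.

Lemma fac_nseq0S : fac (nseq (d 0) O ++ [:: nextl O]).
Proof. by apply/is_pre_fac; have := is_pre_iter0 1; rewrite /= phi1 cats1. Qed.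

Lemma phi_preS j :
  ph (pre j.+1) = ph (pre j) ++ nseq (d (u j)) O ++ [:: nextl (u j)].
Proof. by rewrite preS -cats1 phi_cat phi1 cats1. Qed.

(** A prefix consists of complete blocks followed by some of the zeros that open the next block,
    which is phi([u j]). *)
Lemma pre_decode n :
  exists j r, pre n = ph (pre j) ++ nseq r O /\ r <= d (u j).
Proof.
elim: n => [|n [j [r [E le_r]]]]; first by exists 0, 0.
have pP := is_pre_phi (is_prepre u j.+1).
have nE : n = size (ph (pre j)) + r.
  by rewrite -(size_pre u n) E size_cat size_nseq.
have [lt|ge] := ltnP r (d (u j)).
  move: pP; rewrite phi_preS -(subnKC lt) nseqD -!catA catA => /is_pre_catl /is_preP.
  rewrite size_cat size_nseq addnS -nE => Epre.
  by exists j, r.+1; rewrite -Epre.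
have Er : d (u j) = r by lia.
exists j.+1, 0; split=> //; rewrite cats0; move/is_preP: pP.
by rewrite phi_preS Er !size_cat size_nseq addnA -nE addn1.
Qed.

(** A nonzero letter always ends a block, so w starts at a block boundary. The letter x is the one
    whose block supplies the trailing zeros. *)
Lemma fac_decode (a : A) (w : seq A) : a != O -> fac (a :: w) ->
  exists (a' : A) (w' : seq A) (r : nat) (x : A), [/\ a = nextl a', w = ph w' ++ nseq r O, r <= d x &
    fac (a' :: rcons w' x)].
Proof.
move=> a0 [x]; rewrite -cat1s catA => paw.
have /is_preP Ea := is_pre_catl paw.
have [j [r [Ej le_r]]] := pre_decode (size (x ++ [:: a])).
have [J [R [EJ le_R]]] := pre_decode (size ((x ++ [:: a]) ++ w)).
move/is_preP: paw => Ew; rewrite EJ in Ew; rewrite Ej in Ea.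
case: r => [|r] in Ej le_r Ea; last first.
  move: Ea; rewrite -[r.+1]addn1 nseqD catA !cats1 => /rcons_inj[_ E].
  by rewrite E eqxx in a0.
rewrite cats0 in Ea; case: j => [|j] in Ej le_r Ea; first by case: x Ea {Ej Ew EJ}.
have lejJ : j.+1 <= J.
  rewrite ltnNge; apply/negP => leJj.
  have /prefix_phi : prefix (pre J.+1) (pre j.+1) by apply: prefix_pre.
  rewrite -Ea phi_preS => /size_prefix.
  have := congr1 size Ew; rewrite !size_cat !size_nseq /=; lia.
have [y Ey] := prefixP (prefix_pre u lejJ).
move: Ew; rewrite Ea Ey phi_cat -catA => /eqP.
rewrite eqseq_cat // eqxx => /eqP Ew.
exists (u j), y, R, (u J); split=> //.
  by move: Ea; rewrite phi_preS catA !cats1 => /rcons_inj[].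
by exists (pre j); rewrite -rcons_cons -rcons_cat -cat_rcons -preS -Ey -preS; apply: is_prepre.
Qed.


(** * Unique decoding, left extensions of prefixes, and the order on digit sequences *)

Hypothesis d_neq : d m.-1 <> d (m + p).-1.
Hypothesis d_pos : exists2 k : A, m <= k & 0 < d k.

(* The two letters whose images end in the letter m. *)
Definition preperiod_last : A := inord m.-1.
Definition period_last : A := inord (m + p).-1.

Lemma preperiod_last_val : preperiod_last = m.-1 :> nat.
Proof. by rewrite /preperiod_last inordE //; move: m_gt0; clear; lia. Qed.

Lemma period_last_val : period_last = (m + p).-1 :> nat.
Proof. by rewrite /period_last inordE //; move: m_gt0; clear; lia. Qed.

(** Only m - 1 and m + p - 1 share their image under [nextl], and [d_neq] separates their digits. *)
Lemma nextl_inj_d (a b : A) : nextl a = nextl b -> d a = d b -> a = b.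
Proof.
move=> E Ed; have := congr1 val E; rewrite /= !nextl_val.
have lta := ltn_alphabet a; have ltb := ltn_alphabet b.
case: ltnP => lea; case: ltnP => leb E'; try by apply: val_inj => /=; lia.
  have ea : a = m.-1 :> nat by lia.
  have eb : b = (m + p).-1 :> nat by lia.
  by case: d_neq; rewrite ea eb in Ed.
have ea : b = m.-1 :> nat by lia.
have eb : a = (m + p).-1 :> nat by lia.
by case: d_neq; rewrite ea eb in Ed.
Qed.

Lemma prefix_blocks r r' (c c' : A) v v' : c != O -> c' != O ->
  prefix (nseq r O ++ c :: v) (nseq r' O ++ c' :: v') =
  [&& r == r', c == c' & prefix v v'].
Proof.
move=> c0 c0'; elim: r r' => [|r IH] [|r'] //=.
  by rewrite (negPf c0).
by rewrite eq_sym (negPf c0').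
Qed.

(* The blocks phi(k) form a prefix code, since equal blocks come from equal letters. *)
Lemma prefix_phiE v w : prefix (ph v) (ph w) = prefix v w.
Proof.
apply/idP/idP; last exact: prefix_phi.
elim: v w => [w|a v IH [|b w]]; rewrite ?prefix0s // !phi_cons.
  by rewrite prefixs0; case: (d a).
rewrite prefix_blocks ?nextl_neq0 // => /and3P[/eqP Ed /eqP En /IH].
by rewrite (nextl_inj_d En Ed) /= eqxx.
Qed.

Lemma prefix_iter_phiE i v w : prefix (iter i ph v) (iter i ph w) = prefix v w.
Proof. by elim: i => //= i IH; rewrite prefix_phiE. Qed.

(** Every block ends in a nonzero letter, so the trailing zeros cannot be confused with a block. *)
Lemma phi_nseq0_inj v v' r r' :
  ph v ++ nseq r O = ph v' ++ nseq r' O -> v = v' /\ r = r'.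
Proof.
have bad a (x : seq A) q q' : nseq q O ++ nextl a :: x <> nseq q' O.
  elim: q q' => [|q IH] [|q'] //= [].
    by move/eqP; rewrite (negPf (nextl_neq0 a)).
  exact: IH.
elim: v v' => [|a v IH] [|a' v'].
- by move/(congr1 size); rewrite !size_nseq.
- by rewrite /= phi_cons -catA => /esym /bad.
- by rewrite /= phi_cons -catA => /bad.
rewrite !phi_cons -!catA /= => E.
have : prefix (nseq (d a) O ++ nextl a :: (ph v ++ nseq r O))
              (nseq (d a') O ++ nextl a' :: (ph v' ++ nseq r' O)).
  by rewrite E prefix_refl.
rewrite prefix_blocks ?nextl_neq0 // => /and3P[/eqP Ed /eqP En _].
have Ea := nextl_inj_d En Ed; move: E; rewrite Ea => /eqP.
rewrite eqseq_cat // eqxx /= => /eqP[] E.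
by have [-> ->] := IH _ E.
Qed.

Lemma fac_cons_ext (b : A) w : b != O -> fac (b :: w) -> exists a, fac [:: a, b & w].
Proof.
move=> b0 [x]; case/lastP: x => [|x a]; last by rewrite cat_rcons; exists a, x.
by move/(@is_pre_catl _ u [:: b])/is_preP => -[Eb]; rewrite Eb in b0.
Qed.

(** A positive digit beyond the preperiod yields a factor c 0 with c nonzero. Its image under phi^j
    contains f^j(c) phi^j(0), where phi^j(0) is a long prefix and f^j(c) takes every value from m on
    for arbitrarily large j. *)
Lemma fac_pre (k : A) n : m <= k -> fac (k :: pre n).
Proof.
have [K leK dK] := d_pos.
have K0 : K != O by rewrite -val_eqE /= -lt0n (leq_trans m_gt0).
have [a] := fac_cons_ext K0 (fac_letter K).
move/fac_phi_cons; rewrite phi1; case: (d K) dK => // r _ /= fa.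
have {fa} fa : fac ([:: nextl a; O] ++ rcons (nseq r O) (nextl K)) by [].
move/fac_catl in fa; move=> /(@iter_nextl_reach (nextl a) k n)[j le_nj <-].
have := fac_iter_phi_cons j fa; apply: fac_cons_prefix.
apply: (@is_pre_cmp _ u); [exact: is_prepre | exact: is_pre_iter0 |].
by rewrite size_pre (leq_trans le_nj) // ltnW // size_iter0.
Qed.

Lemma recurrent w : fac w -> exists a, fac (a :: w).
Proof.
case=> x; case/lastP: x => [/is_preP /= ->|x a]; last by rewrite cat_rcons; exists a, x.
by exists period_last; apply: fac_pre; rewrite period_last_val; lia.
Qed.

(* The digit sequence read from k on is lexicographically at most the one read from l on. *)
Definition lexle (k l : A) : Prop := forall i,
  (forall j, j < i -> d (iter j nextl k) = d (iter j nextl l)) ->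
  d (iter i nextl k) <= d (iter i nextl l).

Lemma lexle_nextl (k l : A) : d k = d l -> lexle k l -> lexle (nextl k) (nextl l).
Proof.
move=> Ed le i Hi; rewrite -!iterSr; apply: le => -[|j] //.
by rewrite ltnS => /Hi; rewrite -!iterSr.
Qed.

(* Parry's condition; letter k stands for the shift of d by k places. *)
Hypothesis digit_lex : forall k, lexle k O.

Lemma digit_le (k : A) : d k <= d 0.
Proof. by have H := @digit_lex k 0; apply: H. Qed.

(** Comparing digit sequences compares bodies: common digits contribute common words, and the first
    larger digit supplies an additional image of 0, which already begins with all that remains on
    the smaller side. *)
Lemma body_prefix_lt i (k l : A) : lexle k l ->
  prefix (body i k) (body i l) /\
  ((exists2 j, j < i & d (iter j nextl k) <> d (iter j nextl l)) ->
    size (body i k) < size (body i l)).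
Proof.
elim: i k l => [|i IH] k l le; first by split=> // -[].
have : d k <= d l by apply: (le 0).
rewrite leq_eqVlt => /orP[/eqP Ed|lt] /=.
  have [pb lb] := IH _ _ (lexle_nextl Ed le).
  rewrite Ed !size_cat ltn_add2l; split.
    by rewrite prefix_catr // eqxx.
  case=> -[//|j] lt_ji; rewrite !iterSr => E.
  by apply: lb; exists j.
have [pb _] := IH _ _ (@digit_lex (nextl k)).
(* The image of the additional 0 starts with [body i O], of which [body i (nextl k)] is a prefix by
   Parry's condition. *)
have -> : d l = d k + (1 + (d l - d k - 1)) by lia.
rewrite !nseqD !iter_phi_cat -!catA /= iter_phi1 cat_rcons.
rewrite prefix_catr // eqxx !size_cat ltn_add2l; split.
  exact: prefix_catl.
by move=> _; rewrite /= addnS ltnS (leq_trans (size_prefix pb)) // leq_addr.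
Qed.

Lemma body_pre i k : is_pre (body i k).
Proof.
have [pb _] := body_prefix_lt i (@digit_lex k).
apply: is_pre_prefix pb _; apply: (@is_pre_catl _ u _ [:: iter i nextl O]).
by rewrite cats1 -iter_phi1; apply: is_pre_iter0.
Qed.

Lemma body_nil i k : body i k = [::] -> forall j, j < i -> d (iter j nextl k) = 0.
Proof.
elim: i k => // i IH k /= /eqP; rewrite -size_eq0 size_cat addn_eq0 => /andP[/eqP E1 /nilP E2].
move=> [|j] lt; last by rewrite iterSr IH.
by have := size_iter_phi i (nseq (d k) O); rewrite E1 size_nseq /=; lia.
Qed.

Lemma card_ge_letters (B : {set A}) i :
  (forall k : A, i <= k -> k \in B) -> m + p - i <= #|B|.
Proof.
move=> iB; pose s := [seq (inord k : A) | k <- iota i (m + p - i)].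
have us : uniq s.
  rewrite map_inj_in_uniq ?iota_uniq // => k l; rewrite !mem_iota => lek lel.
  by move/(congr1 val); rewrite /= !inordE //; lia.
rewrite -(size_iota i (m + p - i)) -(size_map (fun k => inord k : A)) -(card_uniqP us).
apply/subset_leq_card/subsetP => x /mapP[k]; rewrite mem_iota => lek ->.
by apply: iB; rewrite inordE; lia.
Qed.

Lemma nseq_rcons (T : Type) n (x : T) : nseq n.+1 x = rcons (nseq n x) x.
Proof. by elim: n => //= n ->. Qed.

Lemma nseq_d0 : nseq (d 0) O = nseq (d 0).-1 O ++ [:: O].
Proof. by rewrite cats1 -nseq_rcons (prednK d0_gt0). Qed.

Lemma fac_pred (a k : A) : k != O -> fac [:: a; k] ->
  exists2 b, k = nextl b &
    (0 < d b /\ a = O) \/ (d b = 0 /\ exists2 a', a = nextl a' & fac [:: a'; b]).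
Proof.
move=> k0 [x pk]; have [j [r [E _]]] := pre_decode (size (x ++ [:: a; k])).
move/is_preP: pk; rewrite E {E}; case: r => [|r]; last first.
  by rewrite nseq_rcons -rcons_cat -cat_rcons cats1 => /rcons_inj[_ Ek]; rewrite Ek in k0.
case: j => [|j]; rewrite cats0; first by case: x.
rewrite phi_preS catA cats1 -cat_rcons cats1 => /rcons_inj[E Ek].
exists (u j) => //; move: E; case Ed: (d (u j)) => [|r]; last first.
  by rewrite nseq_rcons -rcons_cat => /rcons_inj[_ Ea]; left.
rewrite cats0; case: j Ek Ed => [|j] Ek Ed; first by case: x.
rewrite phi_preS catA cats1 => /rcons_inj[E Ea]; right; split=> //.
exists (u j) => //; exists (pre j).
by rewrite -cat_rcons -preS cats1 -preS is_prepre.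
Qed.

(** Desubstitution lowers k by 1 while the digits are 0 and reaches the letter 0 at the first
    positive digit. Avoiding m keeps each preimage under [nextl] unique. *)
Lemma fac_pred_chain z (a k : A) : z < k -> 0 < d (k - z.+1) ->
  (forall i, i < z -> d (k - i.+1) = 0) -> (forall i, i <= z -> k - i <> m) ->
  fac [:: a; k] -> a = iter z nextl O.
Proof.
elim: z a k => [|z IH] a k lt_z d_z d0s nm fak.
all: have k0 : k != O by rewrite -val_eqE /= -lt0n; lia.
all: have [b Ek Hb] := fac_pred k0 fak.
all: have Ek' : k = b.+1 :> nat.
1,3: have := nm 0 isT; rewrite subn0 Ek nextl_val; case: ltnP => //.
all: have Eb : b = k.-1 :> nat by rewrite Ek'.
  by case: Hb => [[_ ->]//|[db _]]; move: d_z; rewrite subn1 -Eb db.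
case: Hb => [[db _]|[_ [a' -> fa]]].
  by move: (d0s 0 isT); rewrite subn1 -Eb; lia.
rewrite iterS (IH a' b) //; first by lia.
- by move: d_z; rewrite Ek' subSS.
- by move=> i lt; have := d0s i.+1 lt; rewrite Ek' subSS.
by move=> i le; have := nm i.+1 le; rewrite Ek' subSS.
Qed.

Hypothesis digit_periodic : forall i, m <= i -> d (i + p) = d i.

Lemma digit_mod j : d (m + j) = d (m + j %% p).
Proof.
rewrite {1}(divn_eq j p) addnC -addnA; elim: (j %/ p) => [|q IH].
  by rewrite mul0n add0n addnC.
by rewrite mulSn -addnA addnC digit_periodic // addnA leq_addl.
Qed.

Lemma last_positive lo hi : lo <= hi -> 0 < d lo ->
  exists j, [/\ lo <= j, j <= hi, 0 < d j & forall i, j < i <= hi -> d i = 0].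
Proof.
move=> le dlo; elim: hi le => [|hi IH].
  by rewrite leqn0 => /eqP lo0; exists lo; split=> //; [rewrite lo0 | lia].
rewrite leq_eqVlt ltnS => /predU1P[<-|/IH[j [lej lej' dj dz]]].
  by exists lo; split=> //; lia.
case Eh: (d hi.+1) => [|x]; last by exists hi.+1; rewrite Eh; split=> //; lia.
exists j; split=> //; first by lia.
by move=> i; case: (i =P hi.+1) => [-> //|ne] lt; apply: dz; lia.
Qed.

(** * Left special factors when the complexity grows slowly *)

Section LowerBound.

Variables X Y : A.
Hypothesis XY : (X = preperiod_last /\ Y = period_last) \/ (X = period_last /\ Y = preperiod_last).
Hypothesis ltYX : d Y < d X.
Hypothesis slow : forall n, complexity u n.+1 < complexity u n + (m + p).

Definition period_first : A := inord m.

Lemma period_first_val : period_first = m :> nat.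
Proof. by rewrite inordE // -[X in X < _]addn0 ltn_add2l. Qed.

Lemma nextl_preperiod_last : nextl preperiod_last = period_first.
Proof.
apply: val_inj; have := period_first_val; have := nextl_val preperiod_last; rewrite preperiod_last_val /= => -> ->.
by case: ltnP => //; lia.
Qed.

Lemma nextl_period_last : nextl period_last = period_first.
Proof.
apply: val_inj; have := period_first_val; have := nextl_val period_last; rewrite period_last_val /= => -> ->.
by case: ltnP => //; lia.
Qed.

Lemma nextl_drop_letters : nextl X = period_first /\ nextl Y = period_first.
Proof. by case: XY => -[-> ->]; rewrite nextl_preperiod_last nextl_period_last. Qed.

Lemma period_first_neq0 : period_first != O.
Proof. by rewrite -nextl_preperiod_last nextl_neq0. Qed.

(* The longest common suffix of phi(X) and phi(Y); phi(X) extends it to the left by 0. *)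
Definition div_word : seq A := rcons (nseq (d Y) O) period_first.

(* phi^i(0^(t-1) 1) without its last letter, with t = d 0: a prefix of u, which f^i(0) extends to the left because
   0 0^(t-1) 1 = phi(0) is a factor. *)
Definition common_ext_at i : seq A := iter i ph (nseq (d 0).-1 O) ++ body i (nextl O).

Definition common_ext : seq A := common_ext_at m.

Lemma common_ext_at_pre i : is_pre (common_ext_at i).
Proof.
apply: (@is_pre_prefix _ _ _ (iter i ph (nseq (d 0) O))); last first.
  exact/is_pre_iter_phi/is_pre_nseq0.
rewrite nseq_d0 iter_phi_cat /common_ext_at prefix_catr // eqxx.
rewrite iter_phi1; apply: prefix_trans (prefix_rcons _ _).
by have [] := body_prefix_lt i (@digit_lex (nextl O)).
Qed.

Lemma fac_common_ext_at i : fac (iter i nextl O :: common_ext_at i).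
Proof.
have : fac (O :: (nseq (d 0).-1 O ++ [:: nextl O])).
  by have := fac_nseq0S; rewrite -(prednK d0_gt0).
move/(fac_iter_phi_cons i); apply: fac_cons_prefix.
by rewrite iter_phi_cat iter_phi1 -rcons_cat prefix_rcons.
Qed.

Lemma common_ext_pre : is_pre common_ext.
Proof. exact: common_ext_at_pre. Qed.

Lemma iter_nextl_preperiod_last : iter m.-1 nextl O = preperiod_last.
Proof. by apply: val_inj; rewrite /= iter_nextl0_val; [have := preperiod_last_val | lia]. Qed.

(** The last letter m + p - 1 extends every prefix, while m - 1 = f^(m-1)(0) extends the image of
    0^(t-1) 1 under phi^(m-1). *)
Lemma fac_common_ext c : c = preperiod_last \/ c = period_last -> exists2 t, fac (c :: t) & prefix common_ext (ph t).
Proof.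
case=> ->; last first.
  exists common_ext.
    by have /is_preP -> := common_ext_pre; apply: fac_pre; rewrite period_last_val; lia.
  by apply: (@is_pre_cmp _ u); rewrite ?size_phi ?is_pre_phi ?common_ext_pre.
exists (iter m.-1 ph (nseq (d 0).-1 O ++ [:: nextl O])).
  rewrite -iter_nextl_preperiod_last; apply: fac_iter_phi_cons.
  by have := fac_nseq0S; rewrite -(prednK d0_gt0).
rewrite -iterS (prednK m_gt0) iter_phi_cat iter_phi1 -rcons_cat.
exact: prefix_rcons.
Qed.

Lemma fac_phi_common_ext c t : nextl c = period_first -> fac (c :: t) -> prefix common_ext (ph t) ->
  fac (nseq (d c) O ++ period_first :: common_ext).
Proof.
move=> nc /fac_phi; rewrite phi_cons nc => fa pV; apply: fac_prefix fa.
by rewrite prefix_catr // eqxx /= eqxx.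
Qed.

(** phi(X) has more zeros than phi(Y), hence one more 0 in front of [div_word]. *)
Lemma fac_0div : fac (O :: div_word ++ common_ext).
Proof.
have [nX nY] := nextl_drop_letters.
have [t fXt pV] := @fac_common_ext X (ltac:(by case: XY => -[-> _]; [left|right])).
have := fac_phi_common_ext nX fXt pV.
have -> : d X = (d X - d Y - 1) + (1 + d Y) by lia.
by rewrite nseqD -catA => /fac_catr; rewrite /div_word cat_rcons.
Qed.

(** Here [div_word] is the whole block phi(Y), preceded by the end of the block phi(a). Together
    with the extension by 0 this makes the word left special. *)
Lemma fac_nextl_div : exists2 a, fac [:: a; Y] & fac (nextl a :: div_word ++ common_ext).
Proof.
have [nX nY] := nextl_drop_letters.
have [t fYt pV] := @fac_common_ext Y (ltac:(by case: XY => -[_ ->]; [right|left])).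
have [a fa] := recurrent fYt.
exists a; first by apply: (@fac_catl _ u [:: a; Y] t).
move: (fac_phi_cons fa); rewrite phi_cons nY => fa'.
apply: fac_cons_prefix fa'.
by rewrite /div_word cat_rcons prefix_catr // eqxx /= eqxx.
Qed.

Lemma div_word_npre : ~~ is_pre div_word.
Proof.
apply/negP => pz.
have p0 : is_pre (nseq (d Y).+1 O).
  by apply: is_pre_nseq0; apply: leq_trans ltYX (digit_le _).
have : div_word = nseq (d Y).+1 O.
  by rewrite (is_preP _ _ pz) (is_preP _ _ p0) size_rcons !size_nseq.
rewrite nseq_rcons /div_word => /rcons_inj[E].
by have := period_first_neq0; rewrite E eqxx.
Qed.

(** This is what keeps the successive images of the new left special word distinct. *)
Lemma div_word_nprefix r : 0 < r -> ~~ prefix div_word (iter r ph (div_word ++ common_ext)).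
Proof.
move=> r0; apply/negP => pz; rewrite iter_phi_cat in pz.
case EY: (d Y) => [|s].
  (* A nonempty body begins with 0, so the body of phi^r(m) would be empty: p divides r and the r
     digits read from m on all vanish, against [d_pos]. *)
  have Ez : div_word = [:: period_first] by rewrite /div_word EY.
  move: pz; rewrite Ez iter_phi1.
  case Eb: (body r period_first) => [|b y]; last first.
    have := body_pre r period_first; rewrite Eb => /(@is_pre_catl _ u [:: b])/is_preP[->].
    by rewrite /= (negPf period_first_neq0).
  rewrite /= => /andP[/eqP E _].
  have Em : period_first = m + (period_first + r - m) %% p :> nat.
    by rewrite {1}E iter_nextl_wrap // period_first_val leq_addr.
  rewrite period_first_val addKn in Em.
  have [K leK dK] := d_pos.
  have ltK := ltn_alphabet K.
  have p_r : p <= r.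
    apply: dvdn_leq => //; apply/eqP; move: Em; case: (_ %% _) => //; lia.
  have lt : K - m < r by lia.
  have := body_nil Eb lt.
  have -> : iter (K - m) nextl period_first = K.
    apply: val_inj; rewrite /= iter_nextl_val period_first_val; lia.
  lia.
(* Now [div_word] starts with 0, whose image begins with [d 0] zeros, more than [d Y]. *)
have Ed : prefix (nseq (d Y).+1 O) (iter r ph div_word).
  have : prefix (iter r ph [:: O]) (iter r ph div_word).
    by apply: prefix_iter_phi; rewrite /div_word EY /= ?eqxx ?prefix0s.
  apply: prefix_trans; apply: (@is_pre_cmp _ u).
  - by apply: is_pre_nseq0; apply: leq_trans ltYX (digit_le _).
  - exact: is_pre_iter0.
  apply: leq_trans (size_iter_phi_le [:: O] r0).
  rewrite /= phi1 size_rcons !size_nseq ltnS.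
  by apply: ltnW; apply: leq_trans ltYX (digit_le _).
have {}Ed := prefix_catl (iter r ph common_ext) Ed.
move: Ed pz; rewrite !prefixE size_rcons !size_nseq => /eqP -> /eqP.
rewrite nseq_rcons /div_word => /esym /rcons_inj[E].
by have := period_first_neq0; rewrite E eqxx.
Qed.

(* The words phi^j(div_word common_ext), for j <= i, are left special, pairwise distinct and no prefixes of u at
   length |phi^i(div_word)|; together with the prefix of u, which has at least m + p - i left extensions, they make the
   complexity grow by at least m + p. *)
Lemma lower_bound a i : fac (nextl a :: div_word ++ common_ext) -> i <= m ->
  size (iter i ph div_word) <= size (div_word ++ common_ext) ->
  (forall k : A, i <= k -> fac (k :: pre (size (iter i ph div_word)))) ->
  ~ (forall j, j <= i -> iter j nextl (nextl a) <> iter j nextl O).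
Proof.
set n := size _ => fa le_im le_n exts neq.
pose W j := iter j ph (div_word ++ common_ext).
have sW j : n <= size (W j) by apply: leq_trans le_n (size_iter_phi _ _).
have zW j : j <= i -> prefix (iter j ph div_word) (take n (W j)).
  move=> le_ji; rewrite prefixE take_takel ?size_iter_phi_le //.
  by rewrite -prefixE prefix_iter_phi // prefix_prefix.
pose s := [seq take n (W j) | j <- iota 0 i.+1].
have us : uniq s.
  (* Since phi is a prefix code, phi^j can be cancelled from a coincidence. *)
  have lt_neq j j' : j < j' -> j <= i -> take n (W j) <> take n (W j').
    move=> lt le_ji E; have /negP := @div_word_nprefix (j' - j) (ltac:(by rewrite subn_gt0)).
    apply; rewrite -(prefix_iter_phiE j) -iterD subnKC ?(ltnW lt) //.
    by apply: prefix_trans (zW _ le_ji) _; rewrite E prefix_take.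
  rewrite map_inj_in_uniq ?iota_uniq // => j j'; rewrite !mem_iota !ltnS /= => lej lej' E.
  by case: (ltngtP j j') => // /lt_neq; [move/(_ lej) | move/(_ lej')]; rewrite E.
have sP : all (fun w => (size w == n) && (w != pre n) && (1 < #|lext u w|)) s.
  apply/allP => w /mapP[j]; rewrite mem_iota /= ltnS => le_ji ->.
  rewrite size_takel // eqxx /=; apply/andP; split.
    apply/negP => /eqP E; have /negP := div_word_npre; apply.
    apply: (@is_pre_prefix _ _ _ (pre n)); last exact: is_prepre.
    rewrite -(prefix_iter_phiE j); apply: prefix_trans (zW _ le_ji) _; rewrite E.
    apply: (@is_pre_cmp _ u); first exact: is_prepre.
      exact/is_pre_iter_phi/is_prepre.
    exact: size_iter_phi.
  apply/card_gt1P; exists (iter j nextl O), (iter j nextl (nextl a)); rewrite !lextE.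
  split; last by apply/eqP => E; apply: (neq _ le_ji).
    apply/asboolP/(fac_cons_prefix (prefix_take _ _)).
    exact/fac_iter_phi_cons/fac_0div.
  apply/asboolP/(fac_cons_prefix (prefix_take _ _)).
  exact: fac_iter_phi_cons.
have := complexity_diff_ge recurrent us sP; rewrite size_map size_iota.
have : m + p - i <= #|lext u (pre n)|.
  by apply: card_ge_letters => k le_ik; rewrite lextE; apply/asboolP/exts.
have := slow n; lia.
Qed.

(** [lower_bound] at i = 0: if [d Y] + 2 <= t, the prefix of length |[div_word]| consists of zeros
    and is still extended by 0, hence by every letter. *)
Lemma Y_digit : d Y = (d 0).-1.
Proof.
have dX := digit_le X.
have [lt|gt|//] := ltngtP (d Y) (d 0).-1; last by lia.
have [a fa fz] := fac_nextl_div.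
have sz : size (iter 0 ph div_word) = (d Y).+1 by rewrite /= size_rcons size_nseq.
have le1 : size (iter 0 ph div_word) <= size (div_word ++ common_ext) by rewrite size_cat leq_addr.
case: (lower_bound fz (leq0n m) le1).
  rewrite sz => k _.
  have Ek : k = iter k nextl O by apply: val_inj; rewrite /= iter_nextl0_val ?ltn_alphabet.
  rewrite Ek; apply: fac_iter_pre.
  have le2 : (d Y).+2 <= d 0 by lia.
  have := is_pre_fac (is_pre_nseq0 le2).
  have /is_preP := is_pre_nseq0 (ltnW le2).
  by rewrite size_nseq => <-.
move=> [|//] _ /=; exact/eqP/nextl_neq0.
Qed.

Lemma X_digit : d X = d 0.
Proof. by have := digit_le X; have := Y_digit; lia. Qed.

Lemma lexle_period_first : lexle period_first (nextl O).
Proof. by have [<- _] := nextl_drop_letters; apply: (@lexle_nextl X O X_digit); apply: digit_lex. Qed.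

(** This is the length condition of [lower_bound] for all i <= m; it rests on the body of m being a
    prefix of the body of 1. *)
Lemma size_div_ext : size (iter m ph div_word) <= size (div_word ++ common_ext).
Proof.
have [/size_prefix le _] := body_prefix_lt m lexle_period_first.
rewrite /div_word -[in iter _ _ _]cats1 iter_phi_cat iter_phi1 /common_ext /common_ext_at.
rewrite !size_cat !size_rcons size_nseq Y_digit addnS addSn ltnS.
by rewrite (leq_trans _ (leq_addl _ _)) // leq_add2l.
Qed.

Lemma iter_nextl_neq0 (b : A) j : b != O -> j < m -> iter j nextl b <> iter j nextl O.
Proof.
rewrite -val_eqE /= => b0 lt E.
have := congr1 val E; rewrite /= iter_nextl0_val; last by lia.
have [le|gt] := leqP m (b + j); first by rewrite iter_nextl_wrap //; lia.
by rewrite iter_nextl_val; lia.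
Qed.

(** [lower_bound] at i = m - 1: a differing digit makes the body of m strictly shorter than that of
    1, so the prefix of the required length is still extended by m - 1. *)
Lemma digit_shift j : j < m.-1 -> d (iter j nextl period_first) = d (iter j nextl (nextl O)).
Proof.
move=> lt_j; apply: contrapT => E.
have [_ lt] := body_prefix_lt m.-1 lexle_period_first.
have {}lt : size (body m.-1 period_first) < size (body m.-1 (nextl O)) by apply: lt; exists j.
have [a fa fz] := fac_nextl_div.
have le1 : size (iter m.-1 ph div_word) <= size (div_word ++ common_ext).
  by apply: leq_trans size_div_ext; apply: size_iter_phi_le; lia.
case: (lower_bound fz (leq_pred m) le1) => [k le_k|i le_i]; last first.
  by apply: iter_nextl_neq0; [exact: nextl_neq0 | lia].
have Ek : k = iter (k - m.-1) nextl (iter m.-1 nextl O).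
  apply: val_inj; rewrite /= -iterD subnK // iter_nextl0_val //; exact: ltn_alphabet.
rewrite Ek; apply: fac_iter_pre; apply: fac_cons_prefix (fac_common_ext_at m.-1).
apply: (@is_pre_cmp _ u); [exact: is_prepre | exact: common_ext_at_pre|].
(* The strict inequality between the bodies pays for the final letter of phi^(m-1)(m). *)
rewrite size_pre /div_word -cats1 iter_phi_cat iter_phi1 size_cat size_rcons.
by rewrite /common_ext_at size_cat Y_digit leq_add2l.
Qed.

(** [lower_bound] at i = m: the letters from m on extend every prefix, so two extensions must
    coincide, which is possible only at j = m. *)
Lemma ext_period : exists2 a, fac [:: a; Y] & iter m.+1 nextl a = iter m nextl O.
Proof.
have [a fa fz] := fac_nextl_div; exists a => //; apply: contrapT => E.
apply: (lower_bound fz (leqnn m) size_div_ext) => [k le_k|j]; first exact: fac_pre.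
rewrite leq_eqVlt => /predU1P[->|lt]; first by rewrite -iterSr.
by apply: iter_nextl_neq0; first exact: nextl_neq0.
Qed.

Lemma digit_iter_period_first j : d (iter j nextl period_first) = d (m + j).
Proof. by rewrite iter_nextl_wrap period_first_val ?leq_addr // addKn -digit_mod. Qed.

Lemma digit_shift_nat j : j < m.-1 -> d (m + j) = d j.+1.
Proof.
move=> lt; rewrite -digit_iter_period_first digit_shift // -iterSr iter_nextl0_val //; lia.
Qed.

Lemma iter_period_dvd (a : A) : iter m.+1 nextl a = iter m nextl O -> p %| a.+1.
Proof.
move/(congr1 val); rewrite /= -iterS iter_nextl_wrap; last by lia.
rewrite iter_nextl0_val; last by lia.
by have -> : a + m.+1 - m = a.+1 by [lia]; rewrite /dvdn => E; apply/eqP; lia.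
Qed.

(** If the period ended in t and the preperiod in t - 1, the letter before Y would force at least p
    - 1 zeros just before the digit t - 1, while [digit_shift_nat] copies the digit t into this
    stretch. *)
Lemma preperiod_drop_absurd : X = period_last -> Y = preperiod_last -> False.
Proof.
move=> EX EY.
have dX : d (m + p).-1 = d 0 by rewrite -X_digit EX period_last_val.
have dY : d m.-1 = (d 0).-1 by rewrite -Y_digit EY preperiod_last_val.
have m_eq1 : m.-1 <> 0 by move=> E; rewrite E in dY; lia.
have [j [_ le_j dj dz]] := @last_positive 0 (m - 2) (leq0n _) d0_gt0.
have [a fa /iter_period_dvd dv] := ext_period.
have Ea : a = iter (m - 2 - j) nextl O.
  have valY : Y = m.-1 :> nat by rewrite EY preperiod_last_val.
  apply: (fac_pred_chain _ _ _ _ fa); rewrite ?valY; first by lia.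
  - by have -> : m.-1 - (m - 2 - j).+1 = j by lia.
  - by move=> i lt; apply: dz; lia.
  by move=> i le; lia.
have va : a = m - 2 - j :> nat by rewrite Ea iter_nextl0_val; lia.
have le_p : p <= m.-1 - j.
  have -> : m.-1 - j = a.+1 by [lia].
  exact: dvdn_leq.
(* The largest multiple of p up to m - 1: position m + i - 1 ends a period and so carries t, which
   the shift copies to position i. *)
pose i := m.-1 - (m.-1 %% p).
have lt_r : m.-1 %% p < p by rewrite ltn_mod.
have dvi : i = m.-1 %/ p * p by rewrite /i {1}(divn_eq m.-1 p) addnK.
have q_gt0 : 0 < m.-1 %/ p by rewrite divn_gt0 //; lia.
have Ei : d (m + i.-1) = d 0.
  rewrite digit_mod; have -> : i.-1 %% p = p.-1.
    have -> : i.-1 = (m.-1 %/ p).-1 * p + p.-1.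
      by rewrite dvi -{1}(prednK q_gt0) mulSn; lia.
    by rewrite modnMDl modn_small //; lia.
  by rewrite -dX; congr d; lia.
have i_gt0 : 0 < i by rewrite dvi muln_gt0 q_gt0.
have lt_ji : j < i <= m.-1 by rewrite /i; lia.
have := @digit_shift_nat i.-1 (ltac:(lia)); rewrite Ei (prednK i_gt0).
have [->|ni1] := i =P m.-1; first by rewrite dY; lia.
have di : d i = 0 by apply: dz; lia.
by rewrite di; lia.
Qed.

Lemma slow_digits : [/\ m = 1, forall j, 0 < j < p -> d j = 0 & d p = (d 0).-1].
Proof.
have [[EX EY]|[EX EY]] := XY; last by case: (preperiod_drop_absurd EX EY).
have dX : d m.-1 = d 0 by rewrite -X_digit EX preperiod_last_val.
have dY : d (m + p).-1 = (d 0).-1 by rewrite -Y_digit EY period_last_val.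
(* From the last positive digit j in this range, the letter before Y is m + p - 2 - j; p would
   divide its successor, which is smaller than p. *)
have zeros i : m <= i < (m + p).-1 -> d i = 0.
  move=> /andP[le_i lt_i]; apply/eqP; rewrite -leqn0 leqNgt; apply/negP => di.
  have [j [le_j lt_j dj dz]] := @last_positive i (m + p - 2) (ltac:(lia)) di.
  have [a fa /iter_period_dvd dv] := ext_period.
  have valY : Y = (m + p).-1 :> nat by rewrite EY period_last_val.
  have Ea : a = iter (m + p - 2 - j) nextl O.
    apply: (fac_pred_chain _ _ _ _ fa); rewrite ?valY; first by lia.
    - by have -> : (m + p).-1 - (m + p - 2 - j).+1 = j by lia.
    - by move=> k lt; apply: dz; lia.
    by move=> k le; lia.
  have va : a = m + p - 2 - j :> nat by rewrite Ea iter_nextl0_val; lia.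
  by have := dvdn_leq (ltn0Sn _) dv; lia.
(* Otherwise the shift copies t = [d (m - 1)] into the period, whose digits are only 0 and t - 1. *)
have m_eq1 : m = 1.
  apply: contrapT => m_neq1; have := @digit_shift_nat (m - 2) (ltac:(lia)).
  have -> : (m - 2).+1 = m.-1 by lia.
  rewrite dX digit_mod; have lt : (m - 2) %% p < p by rewrite ltn_mod.
  have [E|ne] := ((m - 2) %% p) =P p.-1.
    have -> : m + (m - 2) %% p = (m + p).-1 by lia.
    by rewrite dY; lia.
  by rewrite zeros; lia.
split=> // [j lt_j|]; first by apply: zeros; lia.
by rewrite -dY; congr d; lia.
Qed.

End LowerBound.

(** * The word t (0...0 (t-1))^omega *)

Section Sufficiency.

Hypothesis m_eq1 : m = 1.
Hypothesis d_zeros : forall j, 0 < j < p -> d j = 0.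
Hypothesis d_p : d p = (d 0).-1.
Hypothesis d0_gt1 : 1 < d 0.

Lemma period_lastE : period_last = p :> nat.
Proof. by have := period_last_val; lia. Qed.

Lemma period_last_neq0 : period_last != O.
Proof. by rewrite -val_eqE /= period_lastE -lt0n. Qed.

Lemma digit_period_last : d period_last = (d 0).-1.
Proof. by rewrite period_lastE. Qed.

Lemma digit_cases (k : A) : [\/ k = O, k = period_last | k != O /\ d k = 0].
Proof.
have lt := ltn_alphabet k.
have [->|k0] := eqVneq k O; first by constructor 1.
have [->|kp] := eqVneq k period_last; first by constructor 2.
have k0' : k <> 0 :> nat by move: k0; rewrite -val_eqE /= => /eqP.
have kp' : k <> p :> nat by move=> E; case/eqP: kp; apply: val_inj; rewrite /= period_lastE.
by constructor 3; split=> //; apply: d_zeros; lia.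
Qed.

Lemma nextlE (k : A) : nextl k = (if k == p :> nat then 1 else k.+1) :> nat.
Proof. by rewrite nextl_val; case: ltnP; case: eqP; have := ltn_alphabet k; lia. Qed.

Lemma nextl_ord0_period_last : nextl O = nextl period_last.
Proof. by apply: val_inj; rewrite /= !nextlE period_lastE eqxx; case: eqP. Qed.

(** Blocks containing zeros come only from 0 and p, and both end in 1; every other letter is traced
    back one block by induction. *)
Lemma pred_unique (a k : A) : k != O -> fac [:: a; k] -> k = a.+1 :> nat.
Proof.
have [n] := ubnP (nat_of_ord k); elim: n a k => // n IH a k.
rewrite ltnS => le_kn k0 fak.
have [b Ek Hb] := fac_pred k0 fak; rewrite Ek.
case: Hb => [[db ->]|[db [a' Ea fa]]].
  case: (digit_cases b) => [->|->|[_]]; last by lia.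
    by rewrite nextlE; case: eqP.
  by rewrite -nextl_ord0_period_last nextlE; case: eqP.
case: (digit_cases b) => [Eb|Eb|[b0 _]].
- by rewrite Eb /= in db; lia.
- by rewrite Eb digit_period_last in db; lia.
have nb : nextl b = b.+1 :> nat.
  by rewrite nextlE; case: eqP => // Ebp; rewrite Ebp d_p in db; lia.
have Eb : b = a'.+1 :> nat by apply: IH => //; rewrite -nb -Ek.
rewrite nb Ea nextlE; case: eqP => [E|_]; last by rewrite Eb.
by have := ltn_alphabet b; lia.
Qed.

Lemma zeros_split (w : seq A) :
  w = nseq (size w) O \/ exists j k y, k != O /\ w = nseq j O ++ k :: y.
Proof.
elim: w => [|a w [->|[j [k [y [k0 ->]]]]]]; first by left.
- have [->|a0] := eqVneq a O; first by left; rewrite /= size_nseq.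
  by right; exists 0, a, (nseq (size w) O).
have [->|a0] := eqVneq a O; first by right; exists j.+1, k, y.
by right; exists 0, a, (nseq j O ++ k :: y).
Qed.

Lemma fac_nseq0 r : fac (nseq r O) -> r <= d 0.
Proof.
case=> x px; have [j [r' [E le_r]]] := pre_decode (size (x ++ nseq r O)).
move/is_preP: px; rewrite E => {}E; rewrite leqNgt; apply/negP => lt.
have le' : r' <= d 0 by apply: leq_trans le_r (digit_le _).
have Er : r = (r - r').-1.+1 + r' by lia.
move: E; rewrite {1}Er nseqD catA => E.
have sE : size (x ++ nseq (r - r').-1.+1 O) = size (ph (pre j)).
  by have := congr1 size E; rewrite !(size_cat _ (nseq r' O)) => /addIn.
move/eqP: E; rewrite eqseq_cat // => /andP[/eqP E _].
case: j E {sE le_r} => [|j]; first by case: x.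
rewrite phi_preS nseq_rcons catA cats1 -rcons_cat => /rcons_inj[_ E0].
by have := nextl_neq0 (u j); rewrite -E0 eqxx.
Qed.

(** A stretch 0^j k after a nonzero letter is a whole block phi(X). *)
Lemma fac_block (b k : A) j v : b != O -> k != O ->
  fac (b :: nseq j O ++ k :: v) ->
  exists (X : A) (v1 : seq A) (r : nat) (x : A),
    [/\ d X = j /\ nextl X = k, v = ph v1 ++ nseq r O, r <= d x,
      fac (X :: rcons v1 x) & exists2 b', b = nextl b' & fac [:: b'; X]].
Proof.
move=> b0 k0 /(fac_decode b0)[b' [w' [r [x [Eb Ew le_r fa]]]]].
case: w' Ew fa => [|X v1] Ew fa.
  have : k \in nseq r O by rewrite -[nseq r O]cat0s -Ew mem_cat mem_head orbT.
  by case/nseqP=> E; rewrite E eqxx in k0.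
have : prefix (nseq j O ++ k :: v) (nseq (d X) O ++ nextl X :: (ph v1 ++ nseq r O)).
  by rewrite Ew phi_cons -catA prefix_refl.
rewrite prefix_blocks ?nextl_neq0 // => /and3P[/eqP Ej /eqP Ek _].
move: Ew; rewrite phi_cons -catA Ej Ek => /eqP; rewrite eqseq_cat // eqxx /= => /eqP[Ev].
exists X, v1, r, x; split=> //; first exact: (@fac_catr _ u [:: b']).
by exists b' => //; apply: (@fac_catl _ u [:: b'; X] (rcons v1 x)).
Qed.

(** If w begins with 0^j k, k nonzero, the extension by b makes 0^j k a block and the extension by 0
    gives j < t. As j > 0, the block is phi(p), preceded by the image of p - 1, so b = p. *)
Lemma special_form (b : A) w : b != O -> fac (O :: w) -> fac (b :: w) ->
  (w = nseq (size w) O /\ size w < d 0) \/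
  (b = period_last /\ exists v, w = nseq (d 0).-1 O ++ nextl O :: v).
Proof.
move=> b0 f0 fb; have [Ew|[j [k [v [k0 Ew]]]]] := zeros_split w; [left|right].
  by split=> //; apply: (@fac_nseq0 (size w).+1); rewrite /= -Ew.
rewrite {}Ew in f0 fb *.
have [X [v1 [r [x [[dX nX] Ev _ _ [b' Eb fb']]]]]] := fac_block b0 k0 fb.
have lt_j : j < d 0 by apply: (@fac_nseq0 j.+1); apply: (@fac_catl _ u (nseq j.+1 O) (k :: v)).
have j0 : 0 < j.
  (* With j = 0 the letter k would have the two predecessors 0 and b. *)
  rewrite lt0n; apply/eqP => j0; move: f0 fb; rewrite j0 /= => f0 fb.
  have := pred_unique k0 (@fac_catl _ u [:: O; k] v f0).
  have -> := pred_unique k0 (@fac_catl _ u [:: b; k] v fb).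
  by move=> [E]; case/eqP: b0; apply: val_inj.
have EX : X = period_last.
  case: (digit_cases X) => [E|//|[_]]; last by rewrite dX; lia.
  by move: lt_j; rewrite -dX E ltnn.
move: dX nX fb'; rewrite EX digit_period_last -nextl_ord0_period_last => <- <- fb'; split; last by exists v.
have := pred_unique period_last_neq0 fb' => Eb'.
apply: val_inj; rewrite /= Eb nextlE -Eb'; case: eqP => // E; move: Eb'; rewrite period_lastE E; lia.
Qed.

Lemma phi_pre_ext w r c : is_pre (rcons w c) -> r <= d c -> is_pre (ph w ++ nseq r O).
Proof.
move=> /is_pre_phi; rewrite -cats1 phi_cat phi1 => + le; apply: is_pre_prefix.
by rewrite prefix_catr // eqxx -(subnKC le) nseqD rcons_cat prefix_prefix.
Qed.

Lemma is_pre_nextl w : is_pre w -> is_pre (rcons w (u (size w))).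
Proof. by move=> /is_preP E; rewrite {1}E -preS is_prepre. Qed.

(** Induction on the length: w decodes to a shorter word with two distinct left extensions. *)
Lemma pre_special n w (a b : A) : size w < n -> a != b -> a != O -> b != O ->
  fac (a :: w) -> fac (b :: w) -> is_pre w.
Proof.
elim: n w a b => // n IH w a b; rewrite ltnS => le_wn ab a0 b0 fa fb.
have [a' [w' [r [x [Ea Ew le_rx fa']]]]] := fac_decode a0 fa.
have [b' [w2 [r2 [y [Eb Ew2 le_ry fb']]]]] := fac_decode b0 fb.
have [E1 E2] : w' = w2 /\ r = r2 by apply: phi_nseq0_inj; rewrite -Ew.
subst w2 r2; rewrite Ew in le_wn *; clear Ew Ew2.
have ab' : a' != b' by apply: contra ab => /eqP Eab; rewrite Ea Eb Eab.
case: w' fa' fb' le_wn => [|c w'] fa' fb' le_wn.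
  by apply: is_pre_nseq0; apply: leq_trans le_rx (digit_le _).
have c0 : c = O.
  apply/eqP/contraT => c0; case/eqP: ab'; apply: val_inj => /=.
  have := pred_unique c0 (@fac_catl _ u [:: a'; c] _ fa').
  by have -> := pred_unique c0 (@fac_catl _ u [:: b'; c] _ fb') => -[].
subst c; set W := O :: w' in fa' fb' le_wn *.
have ltW : size W + r < n.
  apply: leq_trans le_wn; rewrite size_cat size_nseq -addSn leq_add2r.
  by rewrite phi_cons size_cat size_nseq /= addnS !ltnS; have := size_phi w'; lia.
(* If one decoded extension is 0, W is a run of zeros: otherwise the other one is p, and [nextl]
   identifies 0 with p. *)
have side (e1 e2 : A) : e1 = O -> e2 != e1 -> nextl e1 != nextl e2 ->
    fac (e1 :: W) -> fac (e2 :: W) -> is_pre (ph W ++ nseq r O).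
  move=> -> e20 ne f1 f2; have [[E lt]|[E _]] := special_form e20 f1 f2.
    apply: (@phi_pre_ext _ _ O); last by apply: leq_trans le_rx (digit_le _).
    by rewrite E -nseq_rcons is_pre_nseq0.
  by rewrite E nextl_ord0_period_last eqxx in ne.
have fa1 : fac (a' :: W) by apply: fac_cons_prefix fa'; apply: prefix_rcons.
have fb1 : fac (b' :: W) by apply: fac_cons_prefix fb'; apply: prefix_rcons.
have [Ea'|a'0] := eqVneq a' O.
  by apply: (side a' b') => //; [rewrite eq_sym | rewrite -Ea -Eb].
have [Eb'|b'0] := eqVneq b' O.
  by apply: (side b' a') => //; rewrite -Ea -Eb eq_sym.
have pW : is_pre W by apply: (IH W a' b') => //; lia.
have [r0|r_gt0] := posnP r; first by rewrite r0 cats0; apply: is_pre_phi.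
have [Exy|xy] := eqVneq x y.
  apply: (@phi_pre_ext _ _ x) => //.
  by apply: (IH _ a' b') => //; [rewrite size_rcons; lia | rewrite Exy].
(* The letter c following W in u needs a digit at least r. Since x and y are distinct with positive
   digits, they are 0 and p; so p can follow W, and a nonzero c must then equal p. *)
have pWc := is_pre_nextl pW; move: (u _) pWc => c pWc.
apply: (phi_pre_ext pWc).
have lastW e : is_pre (rcons W e) \/ fac (a' :: rcons W e) \/ fac (b' :: rcons W e) -> e != O ->
    e = (last O W).+1 :> nat.
  move=> He e0; apply: pred_unique => //.
  have : fac (rcons W e).
    by case: He => [/is_pre_fac//|[]]; apply: (@fac_catr _ u [:: _]).
  have -> : rcons W e = belast O w' ++ [:: last O W; e].
    by rewrite -cat_rcons -lastI cats1.
  exact: fac_catr.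
have fc := lastW c (or_introl pWc).
have fx := lastW x (or_intror (or_introl fa')).
have fy := lastW y (or_intror (or_intror fb')).
case: (digit_cases c) => [->|Ec|[c0 dc]]; first by apply: leq_trans le_rx (digit_le _).
  rewrite Ec; case: (digit_cases x) => [Ex|<-//|[_ dx]]; last by rewrite dx leqNgt r_gt0 in le_rx.
  case: (digit_cases y) => [Ey|<-//|[_ dy]]; last by rewrite dy leqNgt r_gt0 in le_ry.
  by rewrite Ex Ey eqxx in xy.
have bad : c <> period_last by move=> E; move: dc d0_gt1; rewrite E digit_period_last; case: (d 0) => [|[]].
case: bad; apply: val_inj => /=; rewrite fc //.
case: (digit_cases x) => [Ex|Ex|[_ dx]]; last by rewrite dx leqNgt r_gt0 in le_rx.
  case: (digit_cases y) => [Ey|Ey|[_ dy]]; last by rewrite dy leqNgt r_gt0 in le_ry.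
    by rewrite Ex Ey eqxx in xy.
  by rewrite -fy ?Ey ?period_last_neq0.
by rewrite -fx ?Ex ?period_last_neq0.
Qed.

(** After 0 the word completes the block phi(0), after p it starts with phi(p); the remainder
    decodes identically, giving a shorter word with the same two extensions. *)
Lemma zero_special_decode (v : seq A) : let w := nseq (d 0).-1 O ++ nextl O :: v in
  fac (O :: w) -> fac (period_last :: w) ->
  exists (v1 : seq A) r (x y : A),
    [/\ v = ph v1 ++ nseq r O, r <= d x, r <= d y,
        fac (O :: rcons v1 x) & fac (period_last :: rcons v1 y)].
Proof.
move=> w f0 fl.
have [X [v1 [r [y [[dX _] Ev le_ry fX _]]]]] := fac_block period_last_neq0 (nextl_neq0 O) fl.
have EX : X = period_last.
  case: (digit_cases X) => [E|//|[_]]; last by rewrite dX; lia.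
  by move: dX; rewrite E /=; lia.
have E0 : O :: w = nseq (d 0) O ++ nextl O :: v by rewrite -(prednK d0_gt0).
rewrite E0 in f0; have [a fa] := recurrent f0.
have a0 : a != O.
  apply/eqP => a0; have /fac_nseq0 : fac (nseq (d 0).+1 O); last by rewrite ltnn.
  by rewrite a0 in fa; apply: (@fac_catl _ u (nseq (d 0).+1 O) (nextl O :: v)).
have [X' [v1' [r' [x [[dX' _] Ev' le_rx fX' _]]]]] := fac_block a0 (nextl_neq0 O) fa.
have EX' : X' = O.
  case: (digit_cases X') => [//|E|[_]]; last by rewrite dX'; lia.
  by move: dX'; rewrite E digit_period_last; lia.
have [E1 E2] : v1' = v1 /\ r' = r by apply: phi_nseq0_inj; rewrite -Ev'.
subst v1' r' X X'; by exists v1, r, x, y.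
Qed.

(** Induction on the length. Runs of zeros shorter than t cannot compete with words starting with
    0^(t-1) 1, and two words of the latter form are decoded and compared. *)
Lemma zero_special_unique n w w' (b b' : A) : size w < n -> size w = size w' ->
  b != O -> b' != O -> fac (O :: w) -> fac (b :: w) ->
  fac (O :: w') -> fac (b' :: w') -> w = w'.
Proof.
elim: n w w' b b' => // n IH w w' b b'; rewrite ltnS => le_wn sw b0 b'0 f0 fb f0' fb'.
have [[Ew lt]|[Eb [v Ew]]] := special_form b0 f0 fb.
  have [[-> _]|[_ [v Ew']]] := special_form b'0 f0' fb'; first by rewrite -sw.
  by move: lt; rewrite sw Ew' size_cat size_nseq /=; lia.
have [[Ew' lt]|[Eb' [v' Ew']]] := special_form b'0 f0' fb'.
  by move: lt; rewrite -sw Ew size_cat size_nseq /=; lia.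
subst b b'; rewrite Ew in f0 fb; rewrite Ew' in f0' fb'.
have [v1 [r [x [y [Ev le_x le_y fx fy]]]]] := zero_special_decode f0 fb.
have [v1' [r' [x' [y' [Ev' le_x' le_y' fx' fy']]]]] := zero_special_decode f0' fb'.
have svv' : size v = size v'.
  by move: sw; rewrite Ew Ew' !size_cat !size_nseq /=; lia.
have szv : size v < n.
  by apply: leq_trans le_wn; rewrite Ew size_cat size_nseq /=; lia.
have szv' : size v' < n by rewrite -svv'.
rewrite {}Ew {}Ew'; congr (_ ++ _ :: _).
clear w w' le_wn sw b0 b'0 f0 fb f0' fb'.
wlog le11 : v v' v1 v1' r r' x x' y y' Ev le_x le_y fx fy Ev' le_x' le_y' fx' fy'
    svv' szv szv' / size v1 <= size v1'.
  move=> W; case: (leqP (size v1) (size v1')) => [le|/ltnW le].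
    exact: (W v v' v1 v1' r r' x x' y y').
  by apply/esym/(W v' v v1' v1 r' r x' x y' y).
have szr : size (ph v1) + r < n by move: szv; rewrite Ev size_cat size_nseq.
have le_ph := size_phi v1.
have pre1 c q : v1' = v1 ++ c :: q ->
    fac (O :: rcons v1 c) /\ fac (period_last :: rcons v1 c).
  by move=> E; split; [move: fx' | move: fy']; rewrite E -cat_rcons rcons_cat -cat_cons; apply: fac_catl.
have Et : take (size v1) v1' = v1.
  apply: (IH _ _ period_last period_last); rewrite ?period_last_neq0 // ?size_takel //; first by lia.
  - apply: fac_cons_prefix fx'; apply: prefix_trans (prefix_take _ _) (prefix_rcons _ _).
  - apply: fac_cons_prefix fy'; apply: prefix_trans (prefix_take _ _) (prefix_rcons _ _).
  - by apply: fac_cons_prefix fx; apply: prefix_rcons.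
  by apply: fac_cons_prefix fy; apply: prefix_rcons.
have := cat_take_drop (size v1) v1'; rewrite Et.
case: (drop _ _) => [|c q] Ev1'.
  move: Ev'; rewrite -Ev1' cats0 => Ev'.
  have : size v = size v' by [].
  by rewrite {1}Ev {1}Ev' !size_cat !size_nseq => /addnI Er; rewrite Ev Ev' Er.
have [fc0 fcl] := pre1 c q (esym Ev1').
have lt_r : d c < r.
  move: svv'; rewrite Ev Ev' -Ev1' phi_cat phi_cons !size_cat !size_nseq /=; lia.
(* A common continuation z would equal c by induction, but [d c] < r. Hence x and y are 0 and p,
   while c is neither; yet p and c follow the same letter, which [pred_unique] forbids. *)
have uniq_x (z : A) : r <= d z -> fac (O :: rcons v1 z) -> fac (period_last :: rcons v1 z) -> False.
  move=> le_z f0z flz.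
  have /rcons_inj[E] : rcons v1 z = rcons v1 c.
    by apply: (IH _ _ period_last period_last); rewrite ?period_last_neq0 ?size_rcons //; lia.
  by move: lt_r; rewrite -E; lia.
have xy : x <> y by move=> E; apply: (uniq_x x) => //; rewrite E.
have xOl : (x = O /\ y = period_last) \/ (x = period_last /\ y = O).
  case: (digit_cases x) => [Ex|Ex|[_ dx]]; last by lia.
    case: (digit_cases y) => [Ey|Ey|[_ dy]]; [by case: xy; rewrite Ex Ey|by left|by lia].
  case: (digit_cases y) => [Ey|Ey|[_ dy]]; [by right|by case: xy; rewrite Ex Ey|by lia].
have lt_cl : d c < d period_last by case: xOl => -[E1 E2]; move: le_x le_y; rewrite E1 E2; lia.
have c0 : c != O.
  by apply/eqP => E; move: lt_cl; rewrite E digit_period_last /=; lia.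
have cl : c <> period_last by move=> E; move: lt_cl; rewrite E ltnn.
case/lastP: v1 fx fy fc0 fcl {Ev szr le_ph pre1 Et Ev1' uniq_x le11} => [|v1 l] fx fy fc0 fcl.
  have := pred_unique c0 fc0; have := pred_unique c0 fcl => -> [] .
  by move/eqP; rewrite period_lastE /=; lia.
have last2 a e : fac (a :: rcons (rcons v1 l) e) -> fac [:: l; e].
  have -> : a :: rcons (rcons v1 l) e = (a :: v1) ++ [:: l; e].
    by rewrite /= -cat_rcons cats1.
  exact: fac_catr.
case: cl; apply: val_inj => /=.
rewrite (pred_unique c0 (last2 _ _ fc0)).
case: xOl => -[E1 E2].
  by rewrite E2 in fy; rewrite (pred_unique period_last_neq0 (last2 _ _ fy)).
by rewrite E1 in fx; rewrite (pred_unique period_last_neq0 (last2 _ _ fx)).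
Qed.

(* The word w is lengthened to 0^(t-1) 1 phi(w), since phi(0) = 0^t 1 and phi(p) = 0^(t-1) 1. *)
Lemma zero_special_exists n : exists2 w, size w = n & fac (O :: w) /\ fac (period_last :: w).
Proof.
suff [w le_nw [f0 fl]] : exists2 w, n <= size w & fac (O :: w) /\ fac (period_last :: w).
  exists (take n w); first by rewrite size_takel.
  by split; [move: f0 | move: fl]; apply/fac_cons_prefix/prefix_take.
elim: n => [|n [w le_nw [f0 fl]]].
  by exists [::] => //; split; apply: fac_letter.
have [a fa] := recurrent fl.
exists (nseq (d period_last) O ++ nextl period_last :: ph w).
  by rewrite size_cat /= addnS ltnS (leq_trans le_nw) // (leq_trans (size_phi w)) // leq_addl.
split.
  move: (fac_phi f0); rewrite phi_cons -nextl_ord0_period_last digit_period_last /=.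
  by rewrite -{1}(prednK d0_gt0).
move: (fac_phi_cons fa); rewrite phi_cons; congr (fac (_ :: _)).
apply: val_inj; have := pred_unique period_last_neq0 (@fac_catl _ u [:: a; period_last] w fa).
by rewrite /= nextlE period_lastE => Ea; case: eqP => E; move: Ea E; clear; lia.
Qed.

(** A word other than the prefix has at most one nonzero extension, so it counts only if 0 extends
    it too. Either the prefix is that unique word and no other counts, or it lacks the extension 0
    and at most one other word adds 1. *)
Lemma complexity_le n : complexity u n.+1 <= complexity u n + p.
Proof.
rewrite (complexity_diff recurrent) leq_add2l.
rewrite (bigD1 (pre_tuple u n)) //= val_pre_tuple.
pose B := [set w : n.-tuple A | (w != pre_tuple u n) && ((O \in lext u w) && (1 < #|lext u w|))].
have ext1 (w : seq A) : (1 < #|lext u w|) -> exists2 b : A, b != O & fac (b :: w).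
  case/card_gt1P=> a [b []]; rewrite !inE => /asboolP fa /asboolP fb ab.
  have [a0|a0] := eqVneq a O; last by exists a.
  by exists b => //; rewrite -a0 eq_sym.
have rest : \sum_(w : n.-tuple A | w != pre_tuple u n) #|lext u w|.-1 <= #|B|.
  rewrite -sum1_card big_mkcond [X in _ <= X]big_mkcond; apply: leq_sum => w _.
  rewrite inE; have [//|nw /=] := eqVneq w (pre_tuple u n).
  have le1 : #|lext u w :\ O| <= 1.
    rewrite leqNgt; apply/negP => /card_gt1P[a [b []]].
    rewrite !inE => /andP[a0 /asboolP fa] /andP[b0 /asboolP fb] ab.
    case/eqP: nw; apply: val_inj; rewrite /= val_pre_tuple.
    have /is_preP := pre_special (ltnSn _) ab a0 b0 fa fb.
    by rewrite size_tuple.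
  have := cardsD1 O (lext u w); move: le1.
  by case: (O \in _) => /=; case: #|lext u w| => [|[|[|k]]] //=; lia.
have mp : (m + p).-1 = p by move: m_eq1; clear; lia.
have fac_period_last : fac (period_last :: pre n) by apply: fac_pre; rewrite period_lastE; lia.
have [O_in|O_notin] := boolP (O \in lext u (pre n)).
  have B0 : #|B| = 0.
    apply: eq_card0 => w; rewrite !inE; apply/negP.
    move=> /andP[/eqP nw /andP[/asboolP f0 /ext1[b b0 fb]]]; case: nw.
    apply: val_inj; rewrite /= val_pre_tuple.
    apply: (@zero_special_unique n.+1 _ _ b period_last) => //; rewrite ?size_tuple ?size_pre ?period_last_neq0 //.
    by move: O_in; rewrite lextE => /asboolP.
  apply: leq_trans (leq_add (leqnn _) rest) _; rewrite B0 addn0.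
  rewrite -subn1 leq_subLR add1n; apply: leq_trans (max_card _) _.
  by rewrite card_ord ltnS; move: mp; clear; lia.
have B1 : #|B| <= 1.
  rewrite leqNgt; apply/negP => /card_gt1P[w [w' []]]; rewrite !inE.
  move=> /andP[_ /andP[/asboolP f0 /ext1[b b0 fb]]] /andP[_ /andP[/asboolP f0' /ext1[b' b'0 fb']]].
  case/eqP; apply: val_inj.
  by apply: (@zero_special_unique n.+1 _ _ b b') => //; rewrite ?size_tuple.
have lt : #|lext u (pre n)| <= p.
  have : #|lext u (pre n)| < #|[set: A]|.
    by apply: proper_card; rewrite properT; apply: contra O_notin => /eqP->.
  by rewrite cardsT card_ord ltnS => /leq_trans; apply; move: mp; clear; lia.
 apply: leq_trans (leq_add (leqnn _) (leq_trans rest B1)) _.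
by case: #|lext u (pre n)| lt => [|c] //=; rewrite addn1.
Qed.

Lemma complexity_ge n : complexity u n + p <= complexity u n.+1.
Proof.
have [w sw [f0 fl]] := zero_special_exists n.
have fpos (k : A) : 1 <= k -> k \in lext u (pre n).
  by move=> k0; rewrite lextE; apply/asboolP/fac_pre; move: m_eq1 k0; clear; lia.
have [Ew|nw] := eqVneq w (pre n).
  have := @complexity_diff_ge _ u recurrent n [::] isT isT.
  have : m + p - 0 <= #|lext u (pre n)|.
    apply: card_ge_letters => k _; case: (posnP k) => [k0|]; last exact: fpos.
    have -> : k = O by apply: val_inj.
    by rewrite lextE; apply/asboolP; rewrite -Ew.
  rewrite /=; lia.
have sP : all (fun w => (size w == n) && (w != pre n) && (1 < #|lext u w|)) [:: w].
  rewrite /= sw eqxx nw /= andbT; apply/card_gt1P; exists O, period_last.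
  by rewrite !lextE; split; rewrite 1?eq_sym ?period_last_neq0 //; apply/asboolP.
have := @complexity_diff_ge _ u recurrent n [:: w] isT sP.
have : m + p - 1 <= #|lext u (pre n)| by apply: card_ge_letters.
rewrite /=; lia.
Qed.

Lemma complexity_affine n : complexity u n = p * n + 1.
Proof.
elim: n => [|n IH]; first by rewrite complexity0 muln0.
by have := complexity_le n; have := complexity_ge n; rewrite IH mulnS; lia.
Qed.

End Sufficiency.

End Substitution.

Import Order.TTheory GRing.Theory Num.Theory.

(** * Renyi expansions *)

Section Renyi.

Local Open Scope ring_scope.

Variables (R : realType) (beta : R).
Hypothesis beta_gt1 : 1 < beta.

Local Notation T := (beta_transform beta).
Local Notation d := (renyi beta).

Lemma beta_transform_itv (x : R) : 0 <= T x < 1.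
Proof.
rewrite /beta_transform subr_ge0 floor_le /= ltrBlDr.
have := ltrDl (Num.floor (beta * x)) 1; rewrite ltr01 floor_lt_int.
by rewrite intrD addrC.
Qed.

Lemma iter_beta_itv n : 0 <= iter n T 1 <= 1.
Proof.
by case: n => [|n]; rewrite ?ler01 ?lexx //=; have /andP[-> /ltW ->] := beta_transform_itv (iter n T 1).
Qed.

Lemma renyiE n : Num.floor (beta * iter n T 1) = (d n)%:Z.
Proof.
have /andP[x0 _] := iter_beta_itv n.
by rewrite /renyi gez0_abs // floor_ge0 mulr_ge0 // (le_trans ler01) ?ltW.
Qed.

Lemma iter_betaS n : iter n.+1 T 1 = beta * iter n T 1 - (d n)%:R.
Proof. by rewrite iterS {1}/beta_transform renyiE. Qed.

Lemma iter_beta_le k l i : iter k T 1 <= iter l T 1 ->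
  (forall j, (j < i)%N -> d (k + j)%N = d (l + j)%N) ->
  iter (k + i)%N T 1 <= iter (l + i)%N T 1.
Proof.
move=> le; elim: i => [|i IH] E; first by rewrite !addn0.
rewrite !addnS !iter_betaS E // lerD2r ler_pM2l ?(lt_trans ltr01) //.
by apply: IH => j lt; apply: E; apply: ltnW.
Qed.

(** Common digits preserve the inequality T^k(1) <= 1 under iteration of T. *)
Lemma renyi_lex k i : (forall j, (j < i)%N -> d (k + j)%N = d j) -> (d (k + i) <= d i)%N.
Proof.
move=> E; rewrite -lez_nat -!renyiE; apply: le_floor.
rewrite ler_pM2l ?(lt_trans ltr01) //; apply: (@iter_beta_le k 0) => //.
by have /andP[] := iter_beta_itv k.
Qed.

Lemma iter_beta_diff k i : (forall j, (j < i)%N -> d (k + j)%N = d j) ->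
  iter i T 1 - iter (k + i)%N T 1 = beta ^+ i * (1 - iter k T 1).
Proof.
elim: i => [|i IH] E; first by rewrite addn0 expr0 mul1r.
rewrite addnS !iter_betaS E // exprS -mulrA -IH; first by ring.
by move=> j lt; apply: E; apply: ltnW.
Qed.

Lemma expr_ge_bernoulli n : 1 + n%:R * (beta - 1) <= beta ^+ n.
Proof.
elim: n => [|n IH]; first by rewrite mul0r addr0 expr0.
have b0 : 0 <= beta by rewrite (le_trans ler01) ?ltW.
rewrite exprS; apply: le_trans (ler_wpM2l b0 IH).
have n0 : 0 <= n%:R :> R by [].
rewrite -natr1 -subr_ge0.
set x := n%:R : R in n0 *.
have -> : beta * (1 + x * (beta - 1)) - (1 + (x + 1) * (beta - 1)) = x * (beta - 1) ^+ 2 by ring.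
by rewrite mulr_ge0 ?sqr_ge0.
Qed.

(* If d_beta(1) were periodic with period k.+1, then T^(k.+1)(1) would be a
   second point with the digits of 1, at a distance from 1 expanding like beta^n. *)
Lemma renyi_not_periodic k : ~ (forall i, d (k.+1 + i)%N = d i).
Proof.
move=> E; pose e := 1 - iter k.+1 T 1.
have e0 : 0 < e by rewrite subr_gt0; have /andP[] := beta_transform_itv (iter k T 1).
have b0 : 0 < beta - 1 by rewrite subr_gt0.
(* Then n (beta - 1) e > 1, so Bernoulli's inequality pushes beta^n e beyond 1, the largest distance
   in [0, 1]. *)
pose n := Num.bound (((beta - 1) * e)^-1).
have : ((beta - 1) * e)^-1 < n%:R.
  by apply: archi_boundP; rewrite invr_ge0 ltW // mulr_gt0.
rewrite -[_^-1]mul1r ltr_pdivrMr ?mulr_gt0 // mulrA => lt.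
have := @iter_beta_diff k.+1 n (fun j _ => E j).
rewrite -/e => De.
have /andP[_ le1] := iter_beta_itv n.
have /andP[ge0 _] := iter_beta_itv (k.+1 + n)%N.
have := ler_wpM2r (ltW e0) (expr_ge_bernoulli n).
by rewrite -De; nra.
Qed.

End Renyi.

Lemma periodic_wordS (t q i : nat) :
  periodic_word [:: t] (rcons (nseq q 0) (t - 1)) i.+1 =
  (if i %% q.+1 == q then t.-1 else 0).
Proof.
rewrite /periodic_word /= size_rcons size_nseq nth_rcons size_nseq !subn1 /=.
have := ltn_pmod i (ltn0Sn q); rewrite ltnS leq_eqVlt => /orP[/eqP-> | lt].
  by rewrite ltnn eqxx.
by rewrite lt (ltn_eqF lt) nth_nseq lt.
Qed.

(** * Application to the expansion of a Parry number *)

Section ParryNumber.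

Variables (R : realType) (beta : R) (m p : nat).
Hypothesis beta_gt1 : (1 < beta)%R.
Hypothesis nsP : nonsimple_parry beta.
Hypothesis parP : parry_parameters beta m p.

Local Notation d := (renyi beta).
Local Notation A := (alphabet m p).
Local Notation nextl := (@nextl m p).

Lemma parry_gt0 : (0 < m) * (0 < p).
Proof. by case: parP => -[]. Qed.

Lemma parry_per i : m <= i -> d (i + p) = d i.
Proof. by case: parP => -[_ _ H] _ /H. Qed.

Lemma digit_iter (k : A) j : d (iter j nextl k) = d (k + j).
Proof.
have [m0 p0] := parry_gt0.
have [le|gt] := leqP m (k + j).
  by rewrite iter_nextl_wrap // -(digit_mod parry_per) subnKC.
by rewrite iter_nextl_val // ltn_addr.
Qed.

Lemma parry_lexle (k : A) : lexle d k (ord0 : A).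
Proof.
move=> i E; rewrite !digit_iter; apply: renyi_lex => // j /E.
by rewrite !digit_iter.
Qed.

(** Equality would let the period start one place earlier, against minimality of m, or, for m = 1,
    make the expansion purely periodic. *)
Lemma parry_digits_neq : d m.-1 <> d (m + p).-1.
Proof.
have [m0 p0] := parry_gt0 => E.
have digit_periodic i : m.-1 <= i -> d (i + p) = d i.
  rewrite leq_eqVlt => /predU1P[<-|lt]; last by apply: parry_per; lia.
  by rewrite E; congr d; lia.
have [m_eq1|m_neq1] := eqVneq m.-1 0.
  apply: (@renyi_not_periodic _ _ beta_gt1 p.-1) => i.
  by rewrite (prednK p0) addnC digit_periodic // m_eq1.
have [_ /(_ m.-1 p)] := parP; case; last by lia.
by split=> //; rewrite lt0n.
Qed.

Lemma parry_pos_letter : exists2 k : A, m <= k & 0 < d k.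
Proof.
have [m0 p0] := parry_gt0; have [_ /(_ m)[i [le_mi di]]] := nsP.
have lt := ltn_pmod (i - m) p0.
exists (inord (m + (i - m) %% p)); rewrite inordE ?ltn_add2l ?leq_addr //.
by rewrite -(digit_mod parry_per) subnKC // lt0n; apply/eqP.
Qed.

Let m_gt0 : 0 < m := parry_gt0.1.
Let p_gt0 : 0 < p := parry_gt0.2.
Let d0_gt0 : 0 < d 0 := renyi0_gt0 beta_gt1.

Lemma complexity_u0 : complexity (@u_beta R beta m p) 0 = 1.
Proof. exact: complexity0. Qed.

Lemma complexity_u1 : complexity (@u_beta R beta m p) 1 = m + p.
Proof.
rewrite complexity1 ?card_ord; last by move=> a; apply: fac_letter.
by rewrite prednK // addn_gt0 m_gt0.
Qed.

Lemma affine_digits : affine R (complexity (@u_beta R beta m p)) ->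
  [/\ m = 1, forall j, 0 < j < p -> d j = 0 & d p = (d 0).-1].
Proof.
case=> a [b aff]; pose C := complexity (@u_beta R beta m p).
(* An affine complexity has the constant difference C(1) - C(0) = m + p - 1. *)
have slow n : C n.+1 < C n + (m + p).
  have : C n.+1 + C 0 = C n + C 1.
    apply/eqP; rewrite -(eqr_nat R) !natrD !aff -natr1; apply/eqP.
    by rewrite mulr0 mulr1 mulrDr mulr1 add0r -!addrA; congr (_ + _)%R; rewrite addrCA.
  by rewrite /C complexity_u0 complexity_u1; lia.
have [lt|gt|E] := ltngtP (d (preperiod_last m p)) (d (period_last m p)).
- apply: (slow_digits m_gt0 p_gt0 d0_gt0 parry_digits_neq parry_pos_letter
    parry_lexle parry_per (X := period_last m p) (Y := preperiod_last m p)) => //; by right.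
- apply: (slow_digits m_gt0 p_gt0 d0_gt0 parry_digits_neq parry_pos_letter
    parry_lexle parry_per (X := preperiod_last m p) (Y := period_last m p)) => //; by left.
by move: E; rewrite (@preperiod_last_val m p m_gt0) (@period_last_val m p m_gt0) => /parry_digits_neq.
Qed.

Lemma digits_affine q :
  (forall i, d i = periodic_word [:: d 0] (rcons (nseq q 0) (d 0 - 1)) i) ->
  affine R (complexity (@u_beta R beta m p)).
Proof.
move=> dE.
have dS i : d i.+1 = if i %% q.+1 == q then (d 0).-1 else 0 by rewrite dE periodic_wordS.
(* Otherwise all digits after the first would vanish. *)
have d0_gt1 : 1 < d 0.
  have [_ /(_ 1)[[|i] [//] _]] := nsP; rewrite dS; case: ifP => // _; lia.
have [_ /(_ 1 q.+1)] := parP; case.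
  by split=> // -[|i] // _; rewrite addSn !dS modnDr.
move=> le_m1 le_pq; have m_eq1 : m = 1 by lia.
have dq : d q.+1 = (d 0).-1 by rewrite dS modn_small ?eqxx.
(* Shifting by p must send the nonzero digit at position q + 1 to a nonzero digit, so q + 1 divides
   p. *)
have pq : p = q.+1.
  have := parry_per (i := q.+1); rewrite m_eq1 dq addSn dS => /(_ isT).
  case: eqP => [E _|_]; last by lia.
  apply/eqP; rewrite eqn_leq le_pq dvdn_leq //.
  have /eqP : q + p = q + 0 %[mod q.+1] by rewrite addn0 E modn_small.
  by rewrite eqn_modDl mod0n.
exists p%:R%R, 1%R => n.
rewrite complexity_affine //.
- by rewrite natrD natrM.
- exact: parry_digits_neq.
- exact: parry_pos_letter.
- exact: parry_lexle.
- move=> [|j] //; rewrite dS => /andP[_ lt]; rewrite modn_small; last by lia.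
  by rewrite ifF //; lia.
by rewrite pq.
Qed.

End ParryNumber.

Local Open Scope ring_scope.

Theorem mainTheorem1 (R : realType) (beta : R) (m p : nat) :
  1 < beta ->
  nonsimple_parry beta ->
  parry_parameters beta m p ->
  (affine R (complexity (@u_beta R beta m p)) <->
  exists q : nat,
    renyi beta =1
      periodic_word [:: renyi beta 0] (rcons (nseq q 0%N) (renyi beta 0 - 1)%N)).
Proof.
move=> beta_gt1 nsP parP; split=> [aff|[q dE]]; last exact: digits_affine dE.
have [m_eq1 dz dp] := affine_digits beta_gt1 nsP parP aff.
have [m_gt0 p_gt0] := parry_gt0 parP.
(* The period of length p consists of p - 1 zeros and the digit t - 1. *)
exists p.-1 => -[|i] //; rewrite periodic_wordS (prednK p_gt0).
have := digit_mod (parry_per parP) i; rewrite m_eq1 !add1n => ->.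
have := ltn_pmod i p_gt0; case: eqP => [-> _|ne lt].
  by rewrite (prednK p_gt0).
by apply: dz; lia.
Qed.
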